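(* Let $(X,T_X)$ be a Turing dynamical system with sets $X_1,\dots,X_n$, associated elements $\gamma_1,\dots,\gamma_n\in\Gamma$, and initial, accepting and rejecting sets $I,A,R$. Let $\mathcal G=\mathcal G(\rho)$ be the action groupoid, let $T:=\sum_{i=1}^n\gamma_i\chi_i\in\mathbb C\mathcal G$, where $\chi_i$ is the characteristic function of $X_i$, and let $$S:=(T+\chi_X-\chi_I-\chi_A-\chi_R)^*(T+\chi_X-\chi_I-\chi_A-\chi_R)+\chi_A\in\mathbb C\mathcal G.$$ If $(X,T_X)$ stops on any configuration and does not restart, then $\dim_{vN}\ker S$ is equal to $\mu(I)-\Omega_2(T_X)$.
   Context: Turing dynamical systems. Let $(X,\mu)$ be a probability space (standard Borel) and $\rho\colon\Gamma\curvearrowright X$ a right probability measure preserving action of a countable discrete group, and let $X=\bigcup_{i=1}^nX_i$ be a division into disjoint measurable subsets (a dynamical hardware). A dynamical software consists of three disjoint subsets $I$ (initial), $R$ (rejecting), $A$ (accepting) of $X$, each a (possibly empty) union of some of the $X_i$, together with a choice of $\gamma_i\in\Gamma$ for each $i$, such that $\gamma_i$ is the neutral element whenever $X_i\subset R\cup A$; and the Turing map $T_X\colon X\to X$, $T_X(x)=\rho(\gamma_i)(x)$ for $x\in X_i$. A Turing dynamical system $(X,T_X)$ is a hardware together with a software. If for some $k$ we have $T_X^k(x)=T_X^{k+1}(x)$, put $T_X^\infty(x):=T_X^k(x)$; otherwise $T_X^\infty(x)$ is undefined. The first fundamental set $\mathcal F_1(T_X)$ consists of those $x\in I$ such that $T_X^\infty(x)\in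 A$ and there is no $y\in X$ with $T_X(y)=x$. The second fundamental set is $\mathcal F_2(T_X)=T_X^\infty(\mathcal F_1(T_X))$. The fundamental values are $\Omega_j(T_X)=\mu(\mathcal F_j(T_X))$, $j=1,2$. $(X,T_X)$ stops on any configuration if for almost every $x$, $T_X^\infty(x)$ is defined and lies in $A\cup R$; it does not restart if $\mu(T_X(X)\cap I)=0$. Action groupoid. $\mathcal G=\mathcal G(\rho)$ has objects $\mathcal G_0=X$ and morphisms $X\times\Gamma$, with $s(x,\gamma)=x$, $r(x,\gamma)=\rho(\gamma)(x)$, composition of $(x,\alpha)$ and $(\rho(\alpha)(x),\beta)$ equal to $(x,\alpha\beta)$, inverse $(x,\gamma)^{-1}=(\rho(\gamma)(x),\gamma^{-1})$. The set of morphisms carries the measure $U\mapsto\int_X|s^{-1}(x)\cap U|\,d\mu(x)$ (product of $\mu$ and counting measure), and $X\subset\mathcal G$ via identity morphisms. Groupoid ring. A measurable edge is a map $\phi\colon\operatorname{Dom}(\phi)\to\mathcal G$, $\operatorname{Dom}(\phi)\subset\mathcal G_0$, with $s\circ\phi$ the inclusion and $r\circ\phi$ injective; $\phi^{-1}$ is the measurable edge with domain $r(\operatorname{Im}\phi)$ and $\phi^{-1}(r(\phi(x)))=\phi(x)^{-1}$. It acts on $L^2(\mathcal G)$ by $\phi(F)(\eta)=F(\eta\,\phi^{-1}(r(\eta)))$ if $r(\eta)\in\operatorname{Dom}(\phi^{-1})$ and $0$ otherwise, where $\eta\eta'$ denotes the composition of $\eta\colon x\to y$ and $\eta'\colon y\to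 z$. $f\in L^\infty(\mathcal G_0)$ acts by $f(F)(\eta)=f(r(\eta))F(\eta)$. $\mathbb C\mathcal G$ is the ${}^*$-ring of bounded operators on $L^2(\mathcal G)$ generated by these. An element $\gamma\in\Gamma$ denotes also the measurable edge $x\mapsto(x,\gamma)$ with domain $X$. $\chi_U\in L^\infty(X)$ is the characteristic function of $U$. The trace is $\tau_{\mathcal G}(T)=\langle T\chi_0,\chi_0\rangle$, $\chi_0$ the characteristic function of $\mathcal G_0\subset\mathcal G$; it is positive, faithful and normal. For self-adjoint $S$, $\dim_{vN}\ker S$ is $\tau_{\mathcal G}$ (extended to the weak closure) of the orthogonal projection onto $\ker S$. *)

(* Defs.v *)
From HB Require Import structures.
From mathcomp Require Import all_boot all_order all_algebra.
From mathcomp Require Import all_classical all_reals all_analysis.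
From mathcomp Require Import complex.

Set Implicit Arguments.
Unset Strict Implicit.
Unset Printing Implicit Defensive.

Import Order.TTheory GRing.Theory Num.Theory.
Import numFieldNormedType.Exports.

Local Open Scope classical_set_scope.
Local Open Scope ring_scope.

(* A Hausdorff complete pseudometric space with a countable basis is a Polish
   space. *)
Definition standard_borel (R : realType) d (X : measurableType d) : Prop :=
  exists (Y : completePseudoMetricType R) (f : X -> Y),
    [/\ hausdorff_space Y, @second_countable Y, bijective f &
      forall U : set X, measurable U <-> <<s @open Y >> (f @` U)].

HB.mixin Record isDiscreteMeasurable d G & Measurable d G := {
  measurable_discrete : forall U : set G, measurable U
}.

(* Countable discrete groups; the discrete sigma-algebra is part of the
   structure so that products with other measurable types are available. *)
#[short(type="discreteGroupType")]
HB.structure Definition DiscreteGroup d :=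
  {G of Measurable d G & Countable G & Group G & isDiscreteMeasurable d G}.

Section counting_sigma_finite.
Context d (G : discreteGroupType d) (R : realType).

(* A separate name, because the library's sigma-finite instance of counting is
   tied to nat. *)
Definition group_counting : set G -> \bar R := @counting G R.

HB.instance Definition _ := Measure.on group_counting.

Let sigma_finite_group_counting : sigma_finite [set: G] group_counting.
Proof.
exists (fun k => [set g : G | (pickle g <= k)%N]).
  by apply/seteqP; split => // g _; exists (pickle g) => /=.
move=> k; split; first exact: measurable_discrete.
suff fink : finite_set [set g : G | (pickle g <= k)%N].
  by rewrite /group_counting /counting/= asboolT// ltry.
apply: (@sub_finite_set _ _ (pickle @^-1` `I_k.+1)); first by move=> g.
apply: finite_preimage; last exact: finite_II.
by move=> x y _ _; exact: (pcan_inj pickleK).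
Qed.

HB.instance Definition _ :=
  @Measure_isSigmaFinite.Build _ _ _ group_counting sigma_finite_group_counting.

End counting_sigma_finite.

Section complex_functions.
Context d (T : measurableType d) (R : realType).
Variable mu : {measure set T -> \bar R}.

(* Complex L^p-functions; elements of the space L^p(mu) are such functions up
   to equality mu-almost everywhere. *)
Definition cLfun (p : \bar R) : set (T -> R[i]) :=
  [set F : T -> R[i] | (@complex.Re R \o F) \in Lfun mu p /\
           (@complex.Im R \o F) \in Lfun mu p].

Definition cintegral (F : T -> R[i]) : R[i] :=
  Complex (\int[mu]_t complex.Re (F t)) (\int[mu]_t complex.Im (F t)).

Definition inner (F G : T -> R[i]) : R[i] :=
  cintegral (fun t => F t * conjc (G t)).

Definition L2norm (F : T -> R[i]) : R := Num.sqrt (complex.Re (inner F F)).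

Definition op := (T -> R[i]) -> (T -> R[i]).

(* Bounded operators on L^2(mu), acting on representatives.  Linearity and
   boundedness together imply compatibility with almost everywhere equality. *)
Definition bounded_op (A : op) : Prop :=
  [/\ forall F, cLfun 2%:E F -> cLfun 2%:E (A F),
      forall (c : R[i]) F G, cLfun 2%:E F -> cLfun 2%:E G ->
        A (fun t => c * F t + G t) = (fun t => c * A F t + A G t) %[ae mu] &
      exists M : R, forall F, cLfun 2%:E F -> L2norm (A F) <= M * L2norm F].

Definition is_adjoint (A B : op) : Prop :=
  bounded_op B /\
  forall F G, cLfun 2%:E F -> cLfun 2%:E G -> inner (A F) G = inner F (B G).

Definition adjoint (A : op) : op := xget 0 [set B | is_adjoint A B].

Definition ker_op (A : op) : set (T -> R[i]) :=
  [set F : T -> R[i] | cLfun 2%:E F /\ A F = (fun=> 0) %[ae mu]].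

Definition is_orth_proj (V : set (T -> R[i])) (Q : op) : Prop :=
  bounded_op Q /\
  forall F, cLfun 2%:E F ->
    V (Q F) /\ forall G, V G -> inner (F - Q F) G = 0.

Definition orth_proj (V : set (T -> R[i])) : op :=
  xget 0 [set Q | is_orth_proj V Q].

End complex_functions.

(* rho (a * b) x = rho b (rho a x): the action is on the right. *)
Record pmp_action d (X : measurableType d) (R : realType) (P : probability X R)
    d' (Gam : discreteGroupType d') := PmpAction {
  act_fun :> Gam -> X -> X ;
  act1 : forall x, act_fun 1%g x = x ;
  actM : forall a b x, act_fun (a * b)%g x = act_fun b (act_fun a x) ;
  act_measurable : forall a, measurable_fun setT (act_fun a) ;
  act_measure_preserving : forall a (U : set X),
    measurable U -> P (act_fun a @^-1` U) = P U
}.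

Section action_groupoid.
Context d (X : measurableType d) (R : realType) (P : probability X R).
Context d' (Gam : discreteGroupType d') (rho : pmp_action P Gam).

Definition groupoid : Type := X * Gam.

Definition gsrc (e : groupoid) : X := e.1.
Definition grng (e : groupoid) : X := rho e.2 e.1.
(* Only meaningful when grng e = gsrc e'. *)
Definition gcomp (e e' : groupoid) : groupoid := (e.1, (e.2 * e'.2)%g).
Definition ginv (e : groupoid) : groupoid := (rho e.2 e.1, e.2^-1%g).

(* By definition of the product measure, gmeas U is the integral over x of the
   cardinality of the section {g | (x, g) \in U}. *)
Definition gmeas : {measure set (X * Gam) -> \bar R} :=
  (P \x @group_counting _ Gam R)%E.

Definition measurable_edge (D : set X) (phi : X -> X * Gam) : Prop :=
  [/\ measurable D, measurable_fun D phi, forall x, D x -> gsrc (phi x) = x &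
      {in D &, injective (grng \o phi)}].

Definition edge_inv_dom (D : set X) (phi : X -> X * Gam) : set X :=
  (grng \o phi) @` D.

Definition edge_inv (D : set X) (phi : X -> X * Gam) (y : X) : X * Gam :=
  ginv (phi (xget y [set x | D x /\ grng (phi x) = y])).

Definition edge_op (D : set X) (phi : X -> X * Gam) : op (X * Gam)%type R :=
  fun F eta => if grng eta \in edge_inv_dom D phi
               then F (gcomp eta (edge_inv D phi (grng eta))) else 0.

Definition mul_op (f : X -> R[i]) : op (X * Gam)%type R :=
  fun F eta => f (grng eta) * F eta.

Definition group_op (g : Gam) : op (X * Gam)%type R :=
  edge_op setT (fun x => (x, g)).

Definition chi_op (U : set X) : op (X * Gam)%type R := mul_op \1_U.

(* The *-ring of bounded operators on L^2(gmeas) generated by measurable edges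
   and L^oo(P).  Closure under the relation is_adjoint (rather than under a
   chosen adjoint) makes it independent of the representation of operators. *)
Inductive groupoid_ring : op (X * Gam)%type R -> Prop :=
| GR_edge D phi : measurable_edge D phi -> groupoid_ring (edge_op D phi)
| GR_mul f : cLfun P +oo%E f -> groupoid_ring (mul_op f)
| GR_add A B : groupoid_ring A -> groupoid_ring B -> groupoid_ring (A + B)
| GR_opp A : groupoid_ring A -> groupoid_ring (- A)
| GR_comp A B : groupoid_ring A -> groupoid_ring B -> groupoid_ring (A \o B)
| GR_adj A B : groupoid_ring A -> is_adjoint gmeas A B -> groupoid_ring B.

Definition chi0 : X * Gam -> R[i] := \1_[set e | e.2 = 1%g].

Definition trace (A : op (X * Gam)%type R) : R[i] :=
  inner gmeas (A chi0) chi0.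

Definition dim_vN_ker (A : op (X * Gam)%type R) : R[i] :=
  trace (orth_proj gmeas (ker_op gmeas A)).

Record turing_system (n : nat) := TuringSystem {
  piece : 'I_n -> set X ;
  piece_measurable : forall i, measurable (piece i) ;
  piece_disjoint : trivIset setT piece ;
  piece_cover : \bigcup_i piece i = setT ;
  init : set X ;
  rej : set X ;
  acc : set X ;
  init_pieces : exists J : set 'I_n, init = \bigcup_(i in J) piece i ;
  rej_pieces : exists J : set 'I_n, rej = \bigcup_(i in J) piece i ;
  acc_pieces : exists J : set 'I_n, acc = \bigcup_(i in J) piece i ;
  init_rej : init `&` rej = set0 ;
  init_acc : init `&` acc = set0 ;
  rej_acc : rej `&` acc = set0 ;
  elt : 'I_n -> Gam ;
  elt_halt : forall i, piece i `<=` rej `|` acc -> elt i = 1%g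
}.

Section turing.
Context n (M : turing_system n).

(* The None case never occurs, by piece_cover. *)
Definition turing_map (x : X) : X :=
  if [pick i : 'I_n | x \in piece M i] is Some i then rho (elt M i) x else x.

(* turing_lim x y: T_X^oo(x) is defined and equal to y. *)
Definition turing_lim (x y : X) : Prop :=
  exists k, iter k turing_map x = iter k.+1 turing_map x /\
            y = iter k turing_map x.

Definition fund1 : set X :=
  [set x | [/\ init M x, exists y, turing_lim x y /\ acc M y &
               ~ exists y, turing_map y = x]].

Definition fund2 : set X := [set y | exists x, fund1 x /\ turing_lim x y].

Definition Omega1 : \bar R := P fund1.
Definition Omega2 : \bar R := P fund2.

Definition stops_on_any_configuration : Prop :=
  {ae P, forall x, exists y, turing_lim x y /\ (acc M `|` rej M) y}.

Definition does_not_restart : Prop := P (range turing_map `&` init M) = 0%E.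

Definition turing_op : op (X * Gam)%type R :=
  \sum_(i < n) (group_op (elt M i) \o chi_op (piece M i)).

Definition turing_S : op (X * Gam)%type R :=
  let D := turing_op + chi_op setT - chi_op (init M) - chi_op (acc M)
           - chi_op (rej M) in
  adjoint gmeas D \o D + chi_op (acc M).

End turing.
End action_groupoid.

(* Main.v *)
(** Write [D = T + 1 - chi_I - chi_A - chi_R], so that [ker S] is the intersection of
    [ker D] and [ker chi_A].  If [step] is [T] restricted to the configurations
    that have not halted, then [D = step + 1 - chi_I], and [chi_I step = 0] since
    the system does not restart.  The Turing map does not expand measure, so
    after discarding an invariant set of small measure every configuration halts
    within [N] steps; then [step] is nilpotent and [ker D] consists of the
    [(1 + step)^-1 g] with [g] supported on [I].  The condition [chi_A = 0] says
    that, for each accepting sink, a signed sum of [g] over the initial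
    configurations leading to it vanishes.

    Averaging over these configurations gives an explicit idempotent [E] of the
    groupoid ring with range [ker S].  If [Q] is the orthogonal projection onto
    [ker S], then [Q E = E] and [E Q = Q], so [Q] and [E] have the same trace.
    By cyclicity, the trace of [E] is the measure of [I] minus the measure of the
    accepting sinks that are reached from [I]. *)

Require Import Defs.
From mathcomp Require Import all_boot all_order all_algebra.
From mathcomp Require Import all_classical all_reals all_analysis.
From mathcomp Require Import measurable_realfun ess_sup_inf complex ring lra.

Set Implicit Arguments.
Unset Strict Implicit.
Unset Printing Implicit Defensive.

Import Order.TTheory GRing.Theory Num.Theory.
Import numFieldNormedType.Exports.

Local Open Scope classical_set_scope.
Local Open Scope ring_scope.

(** * Square integrable functions and orthogonal projections *)

(** In general no single [N] serves almost all of [X], and the Neumann series of [1 + step] is only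
    known to terminate on an invariant set [B] with a uniform halting time. The set [B] must be
    invariant forwards and backwards, so that [chi B] commutes with [D]. A small set of late sinks
    may have a large basin, so the basins are shown to be small by continuity of the measure, not by
    an estimate.

    The idempotent [E] need not be self-adjoint, hence need not be the projection; only the traces
    agree. Its trace collapses by two swaps: the Neumann factor disappears because no step ends in
    [I], and the averaging operator becomes the indicator of the reached sinks.

    Operators act on functions, not on classes. Identities between polynomial operators are thus
    exact equalities, and almost everywhere equality enters only with elements of the kernel, with
    [Q] and with the chosen adjoint of [D]. *)

Lemma ReB (R : realType) (x y : R[i]) :
  complex.Re (x - y) = complex.Re x - complex.Re y.
Proof. by case: x y => [? ?] [? ?]. Qed.

Lemma ImB (R : realType) (x y : R[i]) :
  complex.Im (x - y) = complex.Im x - complex.Im y.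
Proof. by case: x y => [? ?] [? ?]. Qed.

Section hilbert.
Context d (T : measurableType d) (R : realType).
Variable mu : {measure set T -> \bar R}.
Local Notation C := R[i].
Local Notation Re := (@complex.Re R).
Local Notation Im := (@complex.Im R).
Local Notation L2 := (cLfun mu 2%:E).
Implicit Types F G H : T -> C.

Lemma Lfun2P (f : T -> R) : f \in Lfun mu 2%:E <->
  measurable_fun setT f /\ (\int[mu]_t (f t ^+ 2)%:E < +oo)%E.
Proof.
split.
- move=> Lf; have /integrableP[_] := Lfun2_integrable_sqr Lf.
  move: Lf; rewrite inE => /andP[]; rewrite inE/= => mf _.
  move=> h; split=> //; apply: le_lt_trans h.
  apply: ge0_le_integral => //.
  + by move=> x _; rewrite lee_fin sqr_ge0.
  + by apply/measurable_EFinP; exact: measurable_funX.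
  + apply/measurable_EFinP; apply: measurableT_comp => //; exact: measurable_funX.
  + by move=> x _; rewrite /= lee_fin ler_norm.
- move=> [mf h]; rewrite inE; apply/andP; split; rewrite inE//=.
  rewrite /finite_norm unlock /Lnorm; apply: poweR_lty.
  under eq_integral do rewrite /= powR_mulrn// real_normK ?num_real//.
  exact: h.
Qed.

(** The real part of [F t * conjc (G t)]. Norms and orthogonality are treated with this real form;
    [innerE] recovers the complex inner product, whose imaginary part is the real form of [F]
    against ['i * G]. *)
Definition rdot F G (t : T) : R := Re (F t) * Re (G t) + Im (F t) * Im (G t).
Definition l2_dot F G : R := \int[mu]_t rdot F G t.
Local Notation rip := l2_dot.
Definition l2_sqn F : R := rip F F.
Local Notation nrm2 := l2_sqn.

Lemma cLfun_measurable p F : cLfun mu p F ->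
  measurable_fun setT (Re \o F) /\ measurable_fun setT (Im \o F).
Proof. by case; rewrite !inE => /andP[+ _] /andP[+ _]; rewrite !inE. Qed.

Lemma rdot_ge0 F t : 0 <= rdot F F t.
Proof. by rewrite addr_ge0// -expr2 sqr_ge0. Qed.

Lemma cL2P F : L2 F <-> [/\ measurable_fun setT (Re \o F),
  measurable_fun setT (Im \o F) & (\int[mu]_t (rdot F F t)%:E < +oo)%E].
Proof.
have int_sqr (f : T -> R) : measurable_fun setT f ->
    measurable_fun setT (fun t => (f t ^+ 2)%:E).
  by move=> mf; apply/measurable_EFinP; exact: measurable_funX.
have rdotE : measurable_fun setT (Re \o F) -> measurable_fun setT (Im \o F) ->
    (\int[mu]_t (rdot F F t)%:E = \int[mu]_t ((Re \o F) t ^+ 2)%:E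
       + \int[mu]_t ((Im \o F) t ^+ 2)%:E)%E.
  move=> mR mI; rewrite -ge0_integralD//; first last.
  - exact: int_sqr.
  - by move=> t _; rewrite lee_fin sqr_ge0.
  - exact: int_sqr.
  - by move=> t _; rewrite lee_fin sqr_ge0.
split.
- move=> [/Lfun2P[mR iR] /Lfun2P[mI iI]]; split => //.
  by rewrite rdotE// lte_add_pinfty.
- move=> [mR mI]; rewrite rdotE// => h; split; apply/Lfun2P; split => //.
  + by apply: le_lt_trans h; rewrite leeDl// integral_ge0// => t _; rewrite lee_fin sqr_ge0.
  + by apply: le_lt_trans h; rewrite leeDr// integral_ge0// => t _; rewrite lee_fin sqr_ge0.
Qed.

Lemma rdot_integrable F G : L2 F -> L2 G ->
  mu.-integrable setT (EFin \o rdot F G).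
Proof.
move=> [Fr Fi] [Gr Gi].
have h1 := Lfun2_mul_Lfun1 Fr Gr; have h2 := Lfun2_mul_Lfun1 Fi Gi.
by have := integrableD measurableT ((Lfun1_integrable _ _).1 h1)
  ((Lfun1_integrable _ _).1 h2).
Qed.

Lemma L2D F G : L2 F -> L2 G -> L2 (F \+ G).
Proof.
move=> [Fr Fi] [Gr Gi]; split.
- have -> : Re \o (F \+ G) = (Re \o F) + (Re \o G).
    by apply/funext => t; rewrite !fctE /=; case: (F t) (G t) => [? ?] [? ?].
  exact: (Lfun_addr_closed mu (lee1n 2)).2.
- have -> : Im \o (F \+ G) = (Im \o F) + (Im \o G).
    by apply/funext => t; rewrite !fctE /=; case: (F t) (G t) => [? ?] [? ?].
  exact: (Lfun_addr_closed mu (lee1n 2)).2.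
Qed.

Lemma L2_comb (f g : T -> R) (a b : R) : f \in Lfun mu 2%:E -> g \in Lfun mu 2%:E ->
  (fun t => a * f t + b * g t) \in Lfun mu 2%:E.
Proof.
move=> hf hg.
have [_ hZ] := Lfun_submod_closed mu (lee1n 2).
rewrite (_ : (fun t => _) = a *: f + (b *: g + 0)); last first.
  by apply/funext => t; rewrite !fctE addr0.
by apply: (hZ) => //; apply: (hZ) => //; exact: (Lfun_addr_closed mu (lee1n 2)).1.
Qed.

Lemma L2Z (c : C) F : L2 F -> L2 (fun t => c * F t).
Proof.
case: c => a b [Fr Fi]; split.
- rewrite (_ : Re \o _ = fun t => a * (Re \o F) t + (- b) * (Im \o F) t).
    exact: L2_comb.
  by apply/funext => t /=; case: (F t) => x y /=; rewrite mulNr.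
- rewrite (_ : Im \o _ = fun t => a * (Im \o F) t + b * (Re \o F) t).
    exact: L2_comb.
  by apply/funext => t /=; case: (F t) => x y /=.
Qed.

Lemma L20 : L2 (fun=> 0).
Proof.
by split; exact: (Lfun_addr_closed mu (lee1n 2)).1.
Qed.

Lemma L2B F G : L2 F -> L2 G -> L2 (F \- G).
Proof.
move=> hF hG; rewrite (_ : _ \- _ = F \+ (fun t => -1 * G t)); first exact/L2D/L2Z.
by apply/funext => t /=; rewrite mulN1r.
Qed.

Lemma rdot_measurable F G : measurable_fun setT (Re \o F) -> measurable_fun setT (Im \o F) ->
  measurable_fun setT (Re \o G) -> measurable_fun setT (Im \o G) ->
  measurable_fun setT (rdot F G).
Proof. by move=> *; apply: measurable_funD; exact: measurable_funM. Qed.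

Lemma ripC F G : rip F G = rip G F.
Proof. by apply: eq_Rintegral => t _; rewrite /rdot mulrC [X in _ + X]mulrC. Qed.

Lemma ripDl F G H : L2 F -> L2 G -> L2 H -> rip (F \+ G) H = rip F H + rip G H.
Proof.
move=> hF hG hH; rewrite /rip -RintegralD//; try exact: rdot_integrable.
apply: eq_Rintegral => t _; rewrite /rdot /=.
by case: (F t) (G t) (H t) => [? ?] [? ?] [? ?] /=; ring.
Qed.

Lemma ripDr F G H : L2 F -> L2 G -> L2 H -> rip H (F \+ G) = rip H F + rip H G.
Proof. by move=> *; rewrite ripC ripDl// ripC [X in _ + X]ripC. Qed.

Lemma ripZl (a : R) F H : L2 F -> L2 H -> rip (fun t => a%:C%C * F t) H = a * rip F H.
Proof.
move=> hF hH; rewrite /rip -RintegralZl//; try exact: rdot_integrable.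
apply: eq_Rintegral => t _; rewrite /rdot /=.
by case: (F t) (H t) => [? ?] [? ?] /=; ring.
Qed.

Lemma ripZr (a : R) F H : L2 F -> L2 H -> rip H (fun t => a%:C%C * F t) = a * rip H F.
Proof. by move=> *; rewrite ripC ripZl// ripC. Qed.

Lemma ripBl F G H : L2 F -> L2 G -> L2 H -> rip (F \- G) H = rip F H - rip G H.
Proof.
move=> hF hG hH; rewrite /rip -RintegralB//; try exact: rdot_integrable.
apply: eq_Rintegral => t _; rewrite /rdot /=.
by case: (F t) (G t) (H t) => [? ?] [? ?] [? ?] /=; ring.
Qed.

Lemma ripBr F G H : L2 F -> L2 G -> L2 H -> rip H (F \- G) = rip H F - rip H G.
Proof. by move=> *; rewrite ripC ripBl// ripC [X in _ - X]ripC. Qed.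

Lemma nrm2_ge0 F : 0 <= nrm2 F.
Proof. by apply: Rintegral_ge0 => t _; exact: rdot_ge0. Qed.

Lemma EFin_nrm2 F : L2 F -> (nrm2 F)%:E = (\int[mu]_t (rdot F F t)%:E)%E.
Proof.
move=> /cL2P[_ _ h]; rewrite /nrm2 /rip /Rintegral fineK// ge0_fin_numE//.
by apply: integral_ge0 => t _; rewrite lee_fin rdot_ge0.
Qed.

Lemma ae_eq0_nrm2 F : L2 F -> F = (fun=> 0) %[ae mu] <-> nrm2 F = 0.
Proof.
move=> hF; have [mR mI _] := (cL2P _).1 hF.
have mF : measurable_fun setT (EFin \o rdot F F).
  by apply/measurable_EFinP; exact: rdot_measurable.
have := (ae_eq_integral_abs mu measurableT mF).
under eq_integral do rewrite /= ger0_norm ?rdot_ge0//.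
rewrite -EFin_nrm2// => -[h1 h2]; split.
- move=> h; apply: EFin_inj; apply: h2; apply: filterS h => t /(_ I) h _.
  by rewrite /= /rdot h /= !mulr0 addr0.
- move=> h; have {}h : (nrm2 F)%:E = 0%E by rewrite h.
  apply: filterS (h1 h) => t /(_ I) [] /eqP; rewrite /rdot.
  rewrite paddr_eq0 -?expr2 ?sqr_ge0// !sqrf_eq0 => /andP[/eqP h3 /eqP h4] _.
  by apply/eqP; rewrite eq_complex h3 h4 !eqxx.
Qed.

Lemma ae_eq_nrm2 F G : L2 F -> L2 G -> F = G %[ae mu] <-> nrm2 (F \- G) = 0.
Proof.
move=> hF hG; rewrite -ae_eq0_nrm2; last exact: L2B.
by split; apply: filterS => t /(_ I) /= h _; [rewrite h subrr|apply/eqP; rewrite -subr_eq0 h].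
Qed.

Lemma quadratic_ge0 (a b : R) : 0 <= a ->
  (forall s : R, 0 <= 2 * s * b + s ^+ 2 * a) -> b = 0.
Proof.
(* The minimum is at [- b / a]; [a + 1] avoids a vanishing denominator and still makes the quadratic
   nonpositive. *)
move=> a0 h; have := h (- b / (a + 1)).
have a1 : 0 < a + 1 by lra.
have -> : 2 * (- b / (a + 1)) * b + (- b / (a + 1)) ^+ 2 * a =
    - ((b / (a + 1)) ^+ 2 * (a + 2)) by field; lra.
rewrite oppr_ge0 pmulr_lle0; last lra.
move=> h2; have /eqP : (b / (a + 1)) ^+ 2 = 0 by apply/eqP; rewrite eq_le h2 sqr_ge0.
rewrite sqrf_eq0 mulf_eq0 invr_eq0 => /orP[/eqP//|/eqP]; lra.
Qed.

Lemma nrm2DZ F G (s : R) : L2 F -> L2 G ->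
  nrm2 (F \+ (fun t => s%:C%C * G t)) = nrm2 F + 2 * s * rip F G + s ^+ 2 * nrm2 G.
Proof.
move=> hF hG; have hs := L2Z s%:C%C hG.
rewrite /nrm2 ripDl ?ripDr//; try exact: L2D.
by rewrite !ripZr// !ripZl// (ripC G F); ring.
Qed.

Lemma nrm2D F G : L2 F -> L2 G -> nrm2 (F \+ G) = nrm2 F + 2 * rip F G + nrm2 G.
Proof.
by move=> hF hG; rewrite /nrm2 ripDl ?ripDr//; try exact: L2D; rewrite (ripC G F); ring.
Qed.

Lemma nrm2B F G : L2 F -> L2 G -> nrm2 (F \- G) = nrm2 F - 2 * rip F G + nrm2 G.
Proof.
by move=> hF hG; rewrite /nrm2 ripBl ?ripBr//; try exact: L2B; rewrite (ripC G F); ring.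
Qed.

Lemma cauchy_schwarz F G : L2 F -> L2 G -> rip F G ^+ 2 <= nrm2 F * nrm2 G.
Proof.
move=> hF hG.
have h s : 0 <= nrm2 F + 2 * s * rip F G + s ^+ 2 * nrm2 G.
  by rewrite -nrm2DZ//; exact: nrm2_ge0.
have [G0|G0] := eqVneq (nrm2 G) 0.
- have h0 : nrm2 F = 0 \/ 0 < nrm2 F.
    by have := nrm2_ge0 F; rewrite le_eqVlt => /orP[/eqP ->|]; [left|right].
  have : rip F G = 0.
    (* With [nrm2 G = 0] the quadratic is affine in [s]; this [s] gives it the value [-1]. *)
    apply/eqP/negPn/negP => r0; have := h (- (nrm2 F + 1) / (2 * rip F G)).
    rewrite G0 mulr0 addr0.
    have -> : nrm2 F + 2 * (- (nrm2 F + 1) / (2 * rip F G)) * rip F G = -1 by field.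
    lra.
  by move=> ->; rewrite expr0n/= G0 mulr0.
- have G1 : 0 < nrm2 G by rewrite lt_def G0 nrm2_ge0.
  have := h (- rip F G / nrm2 G).
  have -> : nrm2 F + 2 * (- rip F G / nrm2 G) * rip F G +
      (- rip F G / nrm2 G) ^+ 2 * nrm2 G = (nrm2 F * nrm2 G - rip F G ^+ 2) / nrm2 G by field.
  by rewrite pmulr_lge0 ?invr_gt0// subr_ge0.
Qed.

Lemma innerE F G : inner mu F G = (rip F G +i* rip F (fun t => 'i%C * G t))%C.
Proof.
rewrite /inner /cintegral; congr Complex; apply: eq_Rintegral => t _; rewrite /rdot.
- by case: (F t) (G t) => [? ?] [? ?] /=; ring.
- by case: (F t) (G t) => [? ?] [? ?] /=; ring.
Qed.

Lemma Re_inner F G : Re (inner mu F G) = rip F G. Proof. by rewrite innerE. Qed.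

End hilbert.

(** * Completeness of complex L^2 *)

Section riesz_fischer.

(** The increments are at most [Num.sqrt c] times [2^-1 ^+ k], so the telescoping series is
    dominated by a geometric one. *)
Lemma cvg_of_sqr_increments (R : realType) (f : R^nat) (c : R) :
  (forall k, 4 ^+ k * (f k.+1 - f k) ^+ 2 <= c) -> cvgn f.
Proof.
move=> h.
have c0 : 0 <= c by apply: le_trans (h 0%N); rewrite mulr_ge0// sqr_ge0.
have hs : cvgn (series (telescope f)).
  apply: normed_cvg.
  apply: (@series_le_cvg _ _ (geometric (Num.sqrt c) 2^-1)).
  - by move=> n; exact: normr_ge0.
  - by move=> n; rewrite /geometric /= mulr_ge0// ?sqrtr_ge0// exprn_ge0// invr_ge0.
  - move=> n; rewrite /geometric /= exprVn ler_pdivlMr ?exprn_gt0//.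
    rewrite -(@ler_pXn2r _ 2)// ?nnegrE ?sqrtr_ge0 ?mulr_ge0 ?exprn_ge0// sqr_sqrtr//.
    rewrite exprMn real_normK ?num_real//.
    apply: le_trans (h n); rewrite mulrC.
    by rewrite -exprM mulnC exprM (_ : 2 ^+ 2 = 4 :> R)//; ring.
  - by apply: is_cvg_geometric_series; rewrite ger0_norm ?invr_ge0// invf_lt1// ltr1n.
have -> : f = cst (f 0%N) \+ series (telescope f).
  by apply/funext => n /=; rewrite telescopeK /= addrC subrK.
by apply: is_cvgD => //; exact: is_cvg_cst.
Qed.

Context d (T : measurableType d) (R : realType).
Variable mu : {measure set T -> \bar R}.
Local Notation C := R[i].
Local Notation Re := (@complex.Re R).
Local Notation Im := (@complex.Im R).
Local Notation L2 := (cLfun mu 2%:E).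
Local Notation nrm2 := l2_sqn.
Implicit Types F G H : T -> C.

(* The series of the [4 ^+ k * |F_ k.+1 - F_ k|^2] has integral at most
   [\sum_k 2^-k], hence is finite almost everywhere. *)
Lemma cL2_cauchy_ae_bounded (F_ : nat -> T -> C) :
  (forall k, L2 (F_ k)) ->
  (forall k, nrm2 mu (F_ k.+1 \- F_ k) <= 8^-1 ^+ k) ->
  exists2 O : set T, measurable O /\ mu (~` O) = 0%E &
    forall t, O t -> exists c : R, forall k,
      4 ^+ k * rdot (F_ k.+1 \- F_ k) (F_ k.+1 \- F_ k) t <= c.
Proof.
move=> LF cF.
pose D k := F_ k.+1 \- F_ k.
have LD k : L2 (D k) by exact: L2B.
have mD k : measurable_fun setT (rdot (D k) (D k)).
  by have [mR mI _] := (cL2P _ _).1 (LD k); exact: rdot_measurable.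
pose u k t := (4 ^+ k * rdot (D k) (D k) t)%:E.
have u0 k t : (0 <= u k t)%E by rewrite lee_fin mulr_ge0// ?exprn_ge0// rdot_ge0.
have mu_ k : measurable_fun setT (u k).
  by apply/measurable_EFinP; exact: measurable_funM.
have ius : (\int[mu]_t \sum_(k <oo) u k t <= 2%:E)%E.
  rewrite integral_nneseries//.
  have <- : (\sum_(k <oo) (2 / (2 ^ (k + 1))%:R)%:E = 2%:E :> \bar R)%E.
    have := @cvg_geometric_eseries_half R 2 0.
    by rewrite expr0 divr1 => /cvg_lim <-.
  apply: lee_nneseries => [i _ _|k _]; first exact: integral_ge0.
  under eq_integral do rewrite /u EFinM.
  rewrite ge0_integralZl//; first last.
  - by move=> t _; rewrite lee_fin rdot_ge0.
  - exact/measurable_EFinP.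
  rewrite -EFin_nrm2// -EFinM lee_fin.
  apply: (@le_trans _ _ (4 ^+ k * 8^-1 ^+ k)).
    by apply: ler_wpM2l; [exact: exprn_ge0|exact: cF].
  rewrite -exprMn natrX addn1 exprS invfM mulrA divff// mul1r.
  by rewrite -exprVn (_ : 4 * 8^-1 = 2^-1 :> R)//; field.
have s0 t : (0 <= \sum_(k <oo) u k t)%E by apply: nneseries_ge0 => k _ _; exact: u0.
have mS : measurable_fun setT (fun t => \sum_(k <oo) u k t)%E.
  by apply: ge0_emeasurable_sum.
exists [set t | (\sum_(k <oo) u k t < +oo)%E].
- have mO : measurable [set t | (\sum_(k <oo) u k t < +oo)%E].
    by rewrite -[X in measurable X]setTI; exact: emeasurable_fun_infty_o.
  split => //.
  have iS : mu.-integrable setT (fun t => \sum_(k <oo) u k t)%E.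
    apply/integrableP; split => //.
    under eq_integral do rewrite gee0_abs//.
    by apply: le_lt_trans ius _; exact: ltry.
  have [N [mN N0 sN]] := integrable_ae measurableT iS.
  apply/eqP; rewrite eq_le measure_ge0 andbT.
  apply: (@le_trans _ _ (mu N)); last by rewrite N0.
  apply: le_measure; [by rewrite inE; apply: measurableC|by rewrite inE|].
  apply: subset_trans sN => t /= h1 h2; apply: h1; have := h2 I.
  by rewrite ge0_fin_numE.
- move=> t /= ht; exists (fine (\sum_(k <oo) u k t)%E) => k.
  rewrite -lee_fin fineK ?ge0_fin_numE//.
  apply: le_trans (nneseries_lim_ge k.+1 _); last by move=> n _ _; exact: u0.
  rewrite big_nat_recr//= leeDr//.
  by apply: sume_ge0.
Qed.

Lemma sqr_increment_le F G t (f : C -> R) : f = Re \/ f = Im ->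
  (f (F t) - f (G t)) ^+ 2 <= rdot (F \- G) (F \- G) t.
Proof.
case=> ->; rewrite /rdot /= -!expr2.
- by case: (F t) (G t) => [? ?] [? ?] /=; rewrite lerDl sqr_ge0.
- by case: (F t) (G t) => [? ?] [? ?] /=; rewrite lerDr sqr_ge0.
Qed.

(** The rate [8^-1 ^+ k] leaves [2^-1 ^+ k] after the weight [4 ^+ k]; this gives pointwise
    convergence almost everywhere without passing to a subsequence. The limit inherits the rate by
    Fatou's lemma. *)
Lemma riesz_fischer (F_ : nat -> T -> C) :
  (forall k, L2 (F_ k)) ->
  (forall k l, (k <= l)%N -> nrm2 mu (F_ l \- F_ k) <= 8^-1 ^+ k) ->
  exists2 G, L2 G & forall k, nrm2 mu (G \- F_ k) <= 8^-1 ^+ k.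
Proof.
move=> LF cF.
have [A [mO O0] bO] := cL2_cauchy_ae_bounded LF (fun k => cF k k.+1 (leqnSn k)).
(* Setting the functions to zero off [A] makes them converge at every point, so the limit is
   measurable even if [mu] is not complete. *)
pose E k t : C := if t \in A then F_ k t else 0.
have aeE k : F_ k = E k %[ae mu].
  exists (~` A); split; [exact: measurableC|exact: O0|].
  by move=> t /= h Ot; apply: h => _; rewrite /E mem_set.
have mE (f : C -> R) k : f 0 = 0 -> measurable_fun setT (f \o F_ k) ->
    measurable_fun setT (f \o E k).
  move=> f0 mf; rewrite (_ : f \o E k = fun t => \1_A t * (f \o F_ k) t).
    by apply: measurable_funM => //; exact: measurable_indic.
  apply/funext => t /=; rewrite /E indicE; case: ifPn => _; first by rewrite mul1r.
  by rewrite mul0r.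
have mRE k : measurable_fun setT (Re \o E k).
  by apply: mE => //; exact: (cLfun_measurable (LF k)).1.
have mIE k : measurable_fun setT (Im \o E k).
  by apply: mE => //; exact: (cLfun_measurable (LF k)).2.
have dE k l t : rdot (E l \- E k) (E l \- E k) t <= rdot (F_ l \- F_ k) (F_ l \- F_ k) t.
  rewrite {1}/rdot /= /E; case: ifPn => _ /=; first exact: lexx.
  by rewrite subrr /= !mulr0 addr0; exact: rdot_ge0.
have cvE (f : C -> R) t : f 0 = 0 -> f = Re \/ f = Im -> cvgn (fun k => f (E k t)).
  move=> f0 hf; have [Ot|nOt] := pselect (A t).
    have [c hc] := bO _ Ot.
    apply: (@cvg_of_sqr_increments _ _ c) => k; apply: le_trans (hc k).
    by rewrite ler_wpM2l ?exprn_ge0// /E mem_set//; exact: sqr_increment_le.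
  rewrite (_ : (fun k => _) = cst 0); first exact: is_cvg_cst.
  by apply/funext => k; rewrite /E memNset.
pose G t : C := (limn (fun k => Re (E k t)) +i* limn (fun k => Im (E k t)))%C.
have cvR t : (fun k => Re (E k t)) @ \oo --> Re (G t) by apply: cvE => //; left.
have cvI t : (fun k => Im (E k t)) @ \oo --> Im (G t) by apply: cvE => //; right.
have mRG : measurable_fun setT (Re \o G) by apply: measurable_fun_cvg mRE _ => t _; exact: cvR.
have mIG : measurable_fun setT (Im \o G) by apply: measurable_fun_cvg mIE _ => t _; exact: cvI.
have mRB k (H : T -> C) : measurable_fun setT (Re \o H) -> measurable_fun setT (Re \o (H \- E k)).
  move=> mH; rewrite (_ : Re \o _ = (Re \o H) \- (Re \o E k)); first exact: measurable_funB.
  by apply/funext => t /=; rewrite (ReB, ImB).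
have mIB k (H : T -> C) : measurable_fun setT (Im \o H) -> measurable_fun setT (Im \o (H \- E k)).
  move=> mH; rewrite (_ : Im \o _ = (Im \o H) \- (Im \o E k)); first exact: measurable_funB.
  by apply/funext => t /=; rewrite (ReB, ImB).
have fatouG k : (\int[mu]_t (rdot (G \- E k) (G \- E k) t)%:E <= (8^-1 ^+ k)%:E)%E.
  pose f l t := (rdot (E (l + k)%N \- E k) (E (l + k)%N \- E k) t)%:E.
  have cvf t : f ^~ t @ \oo --> (rdot (G \- E k) (G \- E k) t)%:E.
    apply: cvg_EFin; first by exists 0%N.
    rewrite /f /comp /=.
    rewrite (_ : rdot _ _ t = (Re (G t) - Re (E k t)) * (Re (G t) - Re (E k t)) +
       (Im (G t) - Im (E k t)) * (Im (G t) - Im (E k t))); last first.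
      by rewrite /rdot /= !ReB !ImB.
    rewrite (_ : (fun l => _) = fun l : nat =>
       (Re (E (l + k)%N t) - Re (E k t)) * (Re (E (l + k)%N t) - Re (E k t)) +
       (Im (E (l + k)%N t) - Im (E k t)) * (Im (E (l + k)%N t) - Im (E k t))); last first.
      by apply/funext => l; rewrite /rdot /= !ReB !ImB.
    have cR : (fun l => Re (E (l + k)%N t) - Re (E k t)) @ \oo --> Re (G t) - Re (E k t).
      by apply: cvgB; [rewrite (@cvg_shiftn k _ (fun l => Re (E l t)))|exact: cvg_cst].
    have cI : (fun l => Im (E (l + k)%N t) - Im (E k t)) @ \oo --> Im (G t) - Im (E k t).
      by apply: cvgB; [rewrite (@cvg_shiftn k _ (fun l => Im (E l t)))|exact: cvg_cst].
    by apply: cvgD; apply: cvgM.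
  have mf l : measurable_fun setT (f l).
    apply/measurable_EFinP; apply: rdot_measurable;
      by [exact: mRB|exact: mIB].
  under eq_integral => t _ do rewrite -(cvg_limn_einf_sup (cvf t)).1.
  apply: le_trans (fatou mu measurableT mf _) _.
    by move=> l t _; rewrite lee_fin rdot_ge0.
  rewrite limn_einf_lim; apply: lime_le; first exact: is_cvg_einfs.
  near=> l; apply: (@le_trans _ _ (\int[mu]_t f l t)%E).
    by apply: ereal_inf_lbound; exists l => /=.
  apply: (@le_trans _ _ (nrm2 mu (F_ (l + k)%N \- F_ k))%:E); last first.
    by rewrite lee_fin cF// leq_addl.
  rewrite EFin_nrm2; last exact: L2B.
  have [mR mI _] := (cL2P _ _).1 (L2B (LF (l + k)%N) (LF k)).
  apply: ge0_le_integral => //.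
  - by move=> t _; rewrite lee_fin rdot_ge0.
  - by apply/measurable_EFinP; exact: rdot_measurable.
  - by move=> t _; rewrite lee_fin.
have LE k : L2 (E k).
  apply/cL2P; split => //; have /cL2P[mR mI] := LF k; apply: le_lt_trans.
  apply: ge0_le_integral => //.
  - by move=> t _; rewrite lee_fin rdot_ge0.
  - by apply/measurable_EFinP; exact: rdot_measurable.
  - by apply/measurable_EFinP; exact: rdot_measurable.
  - move=> t _; rewrite lee_fin /rdot /E; case: ifPn => // _ /=.
    by rewrite !mulr0 addr0; exact: rdot_ge0.
have LGE k : L2 (G \- E k).
  apply/cL2P; split; [exact: mRB|exact: mIB|].
  by apply: le_lt_trans (fatouG k) _; exact: ltry.
have LG : L2 G.
  rewrite (_ : G = (G \- E 0%N) \+ E 0%N); first exact: L2D.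
  by apply/funext => t /=; rewrite subrK.
exists G => // k.
apply: (@le_trans _ _ (nrm2 mu (G \- E k))); last by rewrite -lee_fin EFin_nrm2.
rewrite -lee_fin !EFin_nrm2//; last exact: L2B.
rewrite le_eqVlt; apply/orP; left; apply/eqP.
have [mR mI _] := (cL2P _ _).1 (L2B LG (LF k)).
apply: ae_eq_integral => //.
- by apply/measurable_EFinP; exact: rdot_measurable.
- by apply/measurable_EFinP; apply: rdot_measurable; [exact: mRB|exact: mIB|exact: mRB|exact: mIB].
- by apply: filterS (aeE k) => t /(_ I) h _; rewrite /rdot /= h.
Unshelve. all: end_near. Qed.
End riesz_fischer.

(** * Orthogonal projections onto closed subspaces *)

Section projection.
Context d (T : measurableType d) (R : realType).
Variable mu : {measure set T -> \bar R}.
Local Notation C := R[i].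
Local Notation Re := (@complex.Re R).
Local Notation Im := (@complex.Im R).
Local Notation L2 := (cLfun mu 2%:E).
Local Notation nrm2 := (l2_sqn mu).
Local Notation rip := (l2_dot mu).
Local Notation op := (op T R).
Implicit Types (F G H : T -> C) (A B Q : op) (V : set (T -> C)).

Lemma L2normE F : L2norm mu F = Num.sqrt (nrm2 F).
Proof. by rewrite /L2norm Re_inner. Qed.

Lemma bounded_op_nrm2 A : bounded_op mu A ->
  exists2 M : R, 0 <= M & forall F, L2 F -> nrm2 (A F) <= M * nrm2 F.
Proof.
case=> _ _ [M hM]; exists (M ^+ 2); first exact: sqr_ge0.
move=> F /hM; rewrite !L2normE => h.
rewrite -(sqr_sqrtr (nrm2_ge0 mu (A F))) -(sqr_sqrtr (nrm2_ge0 mu F)) -exprMn.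
by rewrite ler_sqr ?nnegrE ?sqrtr_ge0//; apply: le_trans h; exact: sqrtr_ge0.
Qed.

Lemma nrm2_bounded_op A :
  (forall F, L2 F -> L2 (A F)) ->
  (forall (c : C) F G, L2 F -> L2 G ->
     A (fun t => c * F t + G t) = (fun t => c * A F t + A G t) %[ae mu]) ->
  (exists M : R, forall F, L2 F -> nrm2 (A F) <= M * nrm2 F) -> bounded_op mu A.
Proof.
move=> LA linA [M hM]; split=> //; exists (Num.sqrt `|M|) => F hF.
rewrite !L2normE -sqrtrM// ler_wsqrtr//; apply: le_trans (hM F hF) _.
by rewrite ler_wpM2r// ?nrm2_ge0// ler_norm.
Qed.

Lemma bounded_op_ae A F G : bounded_op mu A -> L2 F -> L2 G ->
  F = G %[ae mu] -> A F = A G %[ae mu].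
Proof.
move=> bA hF hG FG; have [LA linA _] := bA.
have [M M0 hM] := bounded_op_nrm2 bA.
have := linA (-1) G F hG hF.
set K := (fun t => -1 * G t + F t) => lin.
have hK : L2 K by apply: L2D => //; exact: L2Z.
have K0 : nrm2 K = 0.
  apply/ae_eq0_nrm2 => //; apply: filterS FG => t /(_ I) h _.
  by rewrite /K h mulN1r addNr.
have AK0 : A K = (fun=> 0) %[ae mu].
  apply/ae_eq0_nrm2; first exact: LA.
  by apply/eqP; rewrite eq_le nrm2_ge0 andbT -[leRHS](mulr0 M) -K0 hM.
apply: filterS2 lin AK0 => t /(_ I) h1 /(_ I) h2 _.
by apply/eqP; rewrite -subr_eq0 addrC -mulN1r -h1 h2.
Qed.

Lemma ae_eq_rip F F' G : L2 F -> L2 F' -> L2 G -> F = F' %[ae mu] ->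
  rip F G = rip F' G.
Proof.
move=> hF hF' hG /ae_eq_nrm2 => /(_ hF hF') h; apply/eqP.
rewrite -subr_eq0 -ripBl// -sqrf_eq0 eq_le sqr_ge0 andbT.
by rewrite -(mul0r (nrm2 G)) -h cauchy_schwarz//; exact: L2B.
Qed.

Lemma ae_eq_inner F F' G : L2 F -> L2 F' -> L2 G -> F = F' %[ae mu] ->
  inner mu F G = inner mu F' G.
Proof.
move=> hF hF' hG h; rewrite !innerE (ae_eq_rip hF hF' hG h).
by rewrite (ae_eq_rip hF hF' (L2Z 'i%C hG) h).
Qed.

(** A norm convergent sequence has a subsequence with the rate [8^-1 ^+ k], so this is the usual
    closedness. Applied to constant sequences it also makes [V] stable under almost everywhere
    equality. *)
Definition closed_subspace V :=
  [/\ V `<=` L2, V (fun=> 0),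
      forall (c : C) F G, V F -> V G -> V (fun t => c * F t + G t) &
      forall (F_ : nat -> T -> C) G, (forall k, V (F_ k)) -> L2 G ->
        (forall k, nrm2 (G \- F_ k) <= 8^-1 ^+ k) -> V G].

Lemma closed_subspaceB V F G : closed_subspace V -> V F -> V G -> V (F \- G).
Proof.
move=> [_ _ lin _] VF VG; rewrite (_ : F \- G = fun t => -1 * G t + F t); first exact: lin.
by apply/funext => t /=; rewrite mulN1r addrC.
Qed.

Lemma closed_subspaceZ V c F : closed_subspace V -> V F -> V (fun t => c * F t).
Proof.
move=> [_ V0 lin _] VF; rewrite (_ : (fun t => _) = fun t => c * F t + 0); first exact: lin.
by apply/funext => t /=; rewrite addr0.
Qed.

Lemma closed_subspaceD V F G : closed_subspace V -> V F -> V G -> V (F \+ G).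
Proof.
move=> [_ _ lin _] VF VG; rewrite (_ : F \+ G = fun t => 1 * F t + G t); first exact: lin.
by apply/funext => t /=; rewrite mul1r.
Qed.

Lemma inner_eq0_rip V F : closed_subspace V ->
  (forall G, V G -> rip F G = 0) -> forall G, V G -> inner mu F G = 0.
Proof.
by move=> cV h G VG; rewrite innerE !h//; exact: closed_subspaceZ.
Qed.

(** If [G] and [H] lie in a subspace at nearly minimal distance from [F], the midpoint term is
    bounded below by that distance, so [G] and [H] are close to each other. *)
Lemma parallelogram F G H : L2 F -> L2 G -> L2 H ->
  nrm2 (G \- H) = 2 * nrm2 (F \- G) + 2 * nrm2 (F \- H) -
    4 * nrm2 (F \- (fun t => (2^-1)%:C%C * (G \+ H) t)).
Proof.
move=> hF hG hH; have hGH := L2D hG hH.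
rewrite !nrm2B//; last exact: L2Z.
have -> : nrm2 (fun t => (2^-1)%:C%C * (G \+ H) t) = 4^-1 * nrm2 (G \+ H).
  by rewrite /l2_sqn ripZl ?ripZr//; [field|exact: L2Z].
rewrite ripZr// ripDr// nrm2D//.
by field.
Qed.

Lemma proj_exists V F : closed_subspace V -> L2 F ->
  exists2 P, V P & forall G, V G -> rip (F \- P) G = 0.
Proof.
move=> cV hF; have [VL V0 Vlin Vcl] := cV.
pose S := [set nrm2 (F \- G) | G in V].
have S0 : has_inf S.
  split; first by exists (nrm2 (F \- fun=> 0)), (fun=> 0).
  by exists 0 => _ [G _ <-]; exact: nrm2_ge0.
pose dl := inf S.
have dlP G : V G -> dl <= nrm2 (F \- G).
  by move=> VG; apply: ge_inf; [exact: S0.2|exists G].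
(* The parallelogram identity bounds the squared distance of two such functions by four times the
   larger excess, hence the factor [4^-1]. *)
have ex k : exists G, V G /\ nrm2 (F \- G) < dl + 4^-1 * 8^-1 ^+ k.
  have e0 : 0 < 4^-1 * 8^-1 ^+ k :> R by rewrite mulr_gt0// ?exprn_gt0 ?invr_gt0.
  by have [_ [G VG <-] hG] := inf_adherent e0 S0; exists G.
have [G_ hG_] := choice ex.
have VG k : V (G_ k) := (hG_ k).1.
have LG k : L2 (G_ k) := VL _ (VG k).
have hmono k l : (k <= l)%N -> 8^-1 ^+ l <= 8^-1 ^+ k :> R.
  by move=> kl; rewrite ler_wiXn2l// ?invr_ge0// invf_le1// ler1n.
have cau k l : (k <= l)%N -> nrm2 (G_ l \- G_ k) <= 8^-1 ^+ k.
  move=> kl; rewrite (parallelogram hF)//.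
  have VM : V (fun t => (2^-1)%:C%C * (G_ l \+ G_ k) t).
    by apply: closed_subspaceZ => //; exact: closed_subspaceD.
  have h1 := dlP _ VM; have [_ h2] := hG_ k; have [_ h3] := hG_ l.
  have h4 := hmono _ _ kl.
  by move: h1 h2 h3 h4; lra.
have [P LP hP] := riesz_fischer LG cau.
have VP := Vcl _ _ VG LP hP.
have Pmin : nrm2 (F \- P) <= dl.
  (* With [p = 2 ^+ k], [a = nrm2 (F \- G_ k)] and [b = nrm2 (G_ k \- P)], the cross term is at most
     [p^-1 * a + p * b]. Since [b <= p^-1 ^+ 3], the total is at most
     [(1 + p^-1) * a + p^-1 ^+ 3 + p^-1 ^+ 2], which [u k] bounds. *)
  pose u k : R := (1 + 2^-1 ^+ k) * (dl + 4^-1 * 8^-1 ^+ k) + (8^-1 ^+ k + 4^-1 ^+ k).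
  have cge (a : R) : 1 < a -> (fun k => a^-1 ^+ k) @ \oo --> (0 : R).
    move=> a1; apply: cvg_expr; have a0 : 0 < a by apply: lt_trans a1.
    by rewrite ger0_norm ?invr_ge0 ?ltW// invf_lt1.
  have cu : u @ \oo --> dl.
    rewrite [X in _ --> X](_ : dl = (1 + 0) * (dl + 4^-1 * 0) + (0 + 0)); last by ring.
    apply: cvgD; first apply: cvgM.
    - by apply: cvgD; [exact: cvg_cst|apply: cge; rewrite ltr1n].
    - apply: cvgD; first exact: cvg_cst.
      by apply: cvgM; [exact: cvg_cst|apply: cge; rewrite ltr1n].
    - by apply: cvgD; apply: cge; rewrite ltr1n.
  rewrite -(cvg_lim _ cu)//; apply: limr_ge; first by apply/cvg_ex; exists dl.
  near=> k; rewrite (_ : F \- P = (F \- G_ k) \+ (G_ k \- P)); last first.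
    by apply/funext => t /=; rewrite addrA subrK.
  have LFG : L2 (F \- G_ k) by exact: L2B.
  have LGP : L2 (G_ k \- P) by exact: L2B.
  rewrite nrm2D//.
  have p2 : 0 < 2 ^+ k :> R by rewrite exprn_gt0.
  have := nrm2_ge0 mu ((F \- G_ k) \+ (fun t => (- 2 ^+ k)%:C%C * (G_ k \- P) t)).
  rewrite nrm2DZ//.
  have h1 : nrm2 (G_ k \- P) <= 8^-1 ^+ k.
    rewrite (_ : nrm2 _ = nrm2 (P \- G_ k)) ?hP//.
    by rewrite !nrm2B// (ripC mu P); ring.
  have [_ h2] := hG_ k.
  move: h1 h2; rewrite /u.
  have -> : 8^-1 ^+ k = (2 ^+ k)^-1 ^+ 3 :> R.
    by rewrite -exprVn -!exprM mulnC exprM; congr (_ ^+ _); field.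
  have -> : 4^-1 ^+ k = (2 ^+ k)^-1 ^+ 2 :> R.
    by rewrite -exprVn -!exprM mulnC exprM; congr (_ ^+ _); field.
  rewrite (exprVn 2 k); move: (2 ^+ k : R) p2 => p p2.
  set a := nrm2 (F \- G_ k); set b := nrm2 (G_ k \- P); set c := rip _ _.
  move=> hb ha habc.
  have q0 : 0 < p^-1 by rewrite invr_gt0.
  have : p^-1 * (a + 2 * - p * c + (- p) ^+ 2 * b) >= 0 by rewrite mulr_ge0// ltW.
  have -> : p^-1 * (a + 2 * - p * c + (- p) ^+ 2 * b) = p^-1 * a - 2 * c + p * b.
    by field; rewrite gt_eqF.
  have : p * b <= p^-1 ^+ 2.
    rewrite (_ : p^-1 ^+ 2 = p * p^-1 ^+ 3); last by field; rewrite gt_eqF.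
    by apply: ler_wpM2l => //; exact: ltW.
  have : p^-1 * a <= p^-1 * (dl + 4^-1 * p^-1 ^+ 3) by apply: ler_wpM2l; exact: ltW.
  by lra.
exists P => // H VH.
apply: (@quadratic_ge0 _ (nrm2 H)); first exact: nrm2_ge0.
(* Minimality of [P] against every competitor on a line through [P] makes the linear coefficient
   vanish. *)
move=> s; have VPs : V (P \- (fun t => s%:C%C * H t)).
  by apply: closed_subspaceB => //; exact: closed_subspaceZ.
have := dlP _ VPs.
rewrite (_ : F \- _ = (F \- P) \+ (fun t => s%:C%C * H t)); last first.
  by apply/funext => t /=; rewrite opprB addrA addrAC.
rewrite nrm2DZ//; [|exact/L2B/VL|exact: VL].
by move: Pmin; lra.
Unshelve. all: end_near. Qed.

Lemma proj_unique V F P P' : closed_subspace V -> L2 F -> V P -> V P' ->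
  (forall G, V G -> rip (F \- P) G = 0) ->
  (forall G, V G -> rip (F \- P') G = 0) -> P = P' %[ae mu].
Proof.
move=> cV hF VP VP' h h'; have [VL _ _ _] := cV.
have LP := VL _ VP; have LP' := VL _ VP'; have VB := closed_subspaceB cV VP VP'.
apply/ae_eq_nrm2 => //; rewrite /nrm2.
have := h _ VB; have := h' _ VB; rewrite !ripBl//; try exact: L2B.
by move=> /eqP; rewrite subr_eq0 => /eqP -> /eqP; rewrite subr_eq0 => /eqP ->; rewrite subrr.
Qed.

Lemma orth_proj_ex V : closed_subspace V -> exists Q, is_orth_proj mu V Q.
Proof.
move=> cV; have [VL V0 Vlin Vcl] := cV.
have ex F : exists P, L2 F -> V P /\ forall G, V G -> rip (F \- P) G = 0.
  have [hF|nF] := pselect (L2 F); last by exists F.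
  by have [P VP h] := proj_exists cV hF; exists P.
have [Q hQ] := choice ex.
exists Q; split; last first.
  by move=> F /hQ[VQ h]; split => //; exact: inner_eq0_rip.
apply: nrm2_bounded_op.
- by move=> F /hQ[/VL].
- move=> c F G hF hG; have LcF := L2Z c hF.
  have hcFG : L2 (fun t => c * F t + G t) by exact: L2D.
  have [VQF oF] := hQ _ hF; have [VQG oG] := hQ _ hG; have [VQ oQ] := hQ _ hcFG.
  apply: (proj_unique cV hcFG VQ) => //; first exact: Vlin.
  have e1 H : V H -> inner mu (F \- Q F) H = 0 := inner_eq0_rip cV oF (G := H).
  move=> H VH.
  have LH := VL _ VH; have LQF := VL _ VQF; have LQG := VL _ VQG.
  have LFQ := L2B hF LQF; have LGQ := L2B hG LQG.
  rewrite (_ : (fun t => _) \- _ = (fun t => c * (F \- Q F) t) \+ (G \- Q G)); last first.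
    by apply/funext => t /=; rewrite mulrBr opprD addrACA.
  rewrite ripDl//; last exact: L2Z.
  rewrite oG// addr0.
  have -> : rip (fun t => c * (F \- Q F) t) H = rip (F \- Q F) (fun t => conjc c * H t).
    apply: eq_Rintegral => t _; rewrite /rdot.
    by case: c ((F \- Q F) t) (H t) {hcFG VQ oQ LcF} => [? ?] [? ?] [? ?] /=; ring.
  by rewrite oF//; exact: closed_subspaceZ.
- exists 1 => F hF; have [VQF oF] := hQ _ hF; rewrite mul1r.
  have LQF := VL _ VQF; have LFQ := L2B hF LQF.
  rewrite [leRHS](_ : _ = nrm2 ((F \- Q F) \+ Q F)); last first.
    by congr nrm2; apply/funext => t /=; rewrite subrK.
  by rewrite nrm2D// oF// mulr0 addr0 lerDr nrm2_ge0.
Qed.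

End projection.

(** * Operators on the action groupoid *)

Section groupoid_measure.
Context (R : realType) d (X : measurableType d) (mu : probability X R).
Context d' (Gam : discreteGroupType d').
Variable rho : pmp_action mu Gam.
Local Notation C := R[i].
Local Notation Re := (@complex.Re R).
Local Notation Im := (@complex.Im R).
Local Notation GG := (X * Gam)%type.
Local Notation gm := (gmeas mu Gam).
Local Notation L2 := (cLfun gm 2%:E).
Local Notation nrm2 := (l2_sqn gm).
Local Notation rip := (l2_dot gm).
Local Notation op := (op GG R).
Local Notation chi0 := (@chi0 _ X R _ Gam).
Local Notation trace := (@trace _ X R mu _ Gam).
Implicit Types F G H : GG -> C.

Lemma measurable_slices d1 (Y : measurableType d1) (f : GG -> Y) :
  (forall g, measurable_fun setT (fun x => f (x, g))) -> measurable_fun setT f.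
Proof.
move=> mf _ Z mZ; rewrite setTI.
rewrite (_ : f @^-1` Z = \bigcup_g (((fun x => f (x, g)) @^-1` Z) `*` [set g])).
  apply: countable_bigcupT_measurable; first exact: countableP.
  move=> g; apply: measurableX; last exact: measurable_discrete.
  by rewrite -[X in measurable X]setTI; exact: mf.
apply/seteqP; split => [[x g] /= h|[x g] /= [h _ [/= Zx gh]]].
  by exists g.
by rewrite gh.
Qed.

Lemma counting_bij (s t : Gam -> Gam) (S : set Gam) : cancel s t -> cancel t s ->
  @counting Gam R (s @^-1` S) = counting S.
Proof.
move=> st ts; have e : s @^-1` S = t @` S.
  apply/seteqP; split => g /=; first by move=> h; exists (s g).
  by move=> [h Sh <-]; rewrite ts.
have c : (t @` S #= S)%card.
  by apply: inj_card_eq; apply: in2W; exact: can_inj ts.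
rewrite e /counting.
have [fS|nfS] := pselect (finite_set S).
  have fT : finite_set (t @` S) by exact: finite_image.
  rewrite !asboolT//; congr (_%:R%:E).
  by apply/(fcard_eq fT fS).
by rewrite !asboolF//; rewrite (eq_finite_set c).
Qed.

(** This covers right multiplication ([c] trivial) and left translation ([c] constant) at once. On
    the slice of a fixed [g] it is the action of one group element. *)
Definition fibre_map (c s : Gam -> Gam) (e : GG) : GG := (rho (c e.2) e.1, s e.2).

Lemma fibre_map_measurable c s : measurable_fun setT (fibre_map c s).
Proof.
apply: measurable_slices => g.
apply: measurable_fun_pair; first exact: (act_measurable rho (c g)).
exact: (measurable_cst (s g)).
Qed.

Lemma gmeas_rect (U : set X) (S : set Gam) : measurable U ->
  gm (U `*` S) = (mu U * counting S)%E.
Proof. by move=> mU; exact: product_measure1E mU (measurable_discrete S). Qed.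

Lemma gmeas_slices (B : set GG) : measurable B ->
  gm B = (\int[group_counting R]_(g in [set: Gam]) mu (ysection B g))%E.
Proof.
move=> mB; have h := @product_measure_unique _ _ _ _ _ mu (@group_counting _ Gam R)
  (mu \x^ @group_counting _ Gam R)%E.
by apply: (h _ B mB) => U S mU mS; exact: product_measure2E.
Qed.

(** By uniqueness of the product measure it suffices to compare rectangles [U]*[S]. Integrating over
    [Gam] last, each slice with [s g] in [S] contributes the measure of a translate of [U], and the
    bijection [s] preserves the number of slices. *)
Lemma fibre_map_preserving c s t : cancel s t -> cancel t s ->
  forall B, measurable B -> gm (fibre_map c s @^-1` B) = gm B.
Proof.
move=> st ts B mB; have mphi := fibre_map_measurable c s.
apply/esym.
have huniq := @product_measure_unique _ _ _ _ _ mu (@group_counting _ Gam R)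
  (pushforward gm (fibre_map c s)).
apply: (huniq mphi _ B mB) => U S mU mS.
rewrite -[LHS]/(gm (fibre_map c s @^-1` (U `*` S))) gmeas_slices; last first.
  by rewrite -[X in measurable X]setTI; apply: mphi => //; exact: measurableX.
transitivity (\int[group_counting R]_(g in [set: Gam]) (mu U * (\1_(s @^-1` S) g)%:E))%E.
  apply: eq_integral => g _; rewrite indicE.
  have [gS|gS] := boolP (g \in s @^-1` S).
  - rewrite mule1 -(act_measure_preserving rho (c g) mU); congr (mu _).
    apply/seteqP; split => x; rewrite /= /ysection /= inE.
      by case.
    by move=> h; split => //; rewrite inE in gS.
  - rewrite mule0 -(measure0 mu); congr (mu _).
    rewrite -subset0 => x; rewrite /ysection /= inE => -[/= _ h].
    by move: gS; rewrite notin_setE => /(_ h).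
rewrite ge0_integralZl//; last first.
- by apply/measurable_EFinP; apply: measurable_indic; exact: measurable_discrete.
rewrite integral_indic//; last exact: measurable_discrete.
by rewrite setIT; congr (_ * _)%E; exact: (counting_bij _ st ts).
Qed.

Section composition.
Variables (c s t : Gam -> Gam) (st : cancel s t) (ts : cancel t s).
Let phi := fibre_map c s.

Lemma integral_fibre_map (f : GG -> \bar R) : measurable_fun setT f ->
  (forall e, 0 <= f e)%E -> (\int[gm]_e f (phi e) = \int[gm]_e f e)%E.
Proof.
move=> mf f0.
have := ge0_integral_pushforward (fibre_map_measurable c s) gm measurableT mf
  (fun e _ => f0 e).
rewrite preimage_setT => <-.
apply: eq_measure_integral; first exact: fibre_map_measurable.
by move=> ? B mB _; exact: (fibre_map_preserving c st ts mB).
Qed.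

Lemma measurable_fibre_map (f : GG -> R) : measurable_fun setT f ->
  measurable_fun setT (f \o phi).
Proof. by move=> mf; apply: measurableT_comp => //; exact: fibre_map_measurable. Qed.

Lemma L2_fibre_map F : L2 F -> L2 (F \o phi).
Proof.
move=> /cL2P[mR mI h]; apply/cL2P; split.
- exact: (measurable_fibre_map mR).
- exact: (measurable_fibre_map mI).
- rewrite (integral_fibre_map (f := fun e => (rdot F F e)%:E))//.
    by apply/measurable_EFinP; exact: rdot_measurable.
  by move=> e; rewrite lee_fin rdot_ge0.
Qed.

Lemma nrm2_fibre_map F : L2 F -> nrm2 (F \o phi) = nrm2 F.
Proof.
move=> LF; apply: EFin_inj; rewrite !EFin_nrm2//; last exact: L2_fibre_map.
have [mR mI _] := (cL2P _ _).1 LF.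
rewrite (integral_fibre_map (f := fun e => (rdot F F e)%:E))//.
  by apply/measurable_EFinP; exact: rdot_measurable.
by move=> e; rewrite lee_fin rdot_ge0.
Qed.

(** Polarization of [nrm2_fibre_map]. *)
Lemma rip_fibre_map F G : L2 F -> L2 G -> rip (F \o phi) (G \o phi) = rip F G.
Proof.
move=> LF LG.
have := nrm2D (L2_fibre_map LF) (L2_fibre_map LG).
rewrite -[X in nrm2 X]/((F \+ G) \o phi) !nrm2_fibre_map//; last exact: L2D.
by rewrite nrm2D//; lra.
Qed.

End composition.
End groupoid_measure.

(** * Multiplication by real functions; sesquilinearity of the inner product *)

Section multiplication.
Context d (T : measurableType d) (R : realType).
Variable mu : {measure set T -> \bar R}.
Local Notation C := R[i].
Local Notation Re := (@complex.Re R).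
Local Notation Im := (@complex.Im R).
Local Notation L2 := (cLfun mu 2%:E).
Local Notation nrm2 := l2_sqn.
Local Notation rip := l2_dot.
Implicit Types F G H : T -> C.

Definition rmul (h : T -> R) F : T -> C := fun t => (h t)%:C%C * F t.

Definition bounded_measurable (h : T -> R) :=
  measurable_fun setT h /\ exists K : R, forall t, `|h t| <= K.

Lemma L2_rmul (h : T -> R) F (K : R) : measurable_fun setT h -> (forall t, `|h t| <= K) -> L2 F ->
  L2 (rmul h F) /\ nrm2 mu (rmul h F) <= K ^+ 2 * nrm2 mu F.
Proof.
move=> mh hK LF; have [mR mI iF] := (cL2P _ _).1 LF.
have mR' : measurable_fun setT (Re \o rmul h F).
  rewrite (_ : _ \o _ = h \* (Re \o F)); first exact: measurable_funM.
  by apply/funext => t; rewrite /rmul /=; case: (F t) => ? ? /=; rewrite mul0r subr0.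
have mI' : measurable_fun setT (Im \o rmul h F).
  rewrite (_ : _ \o _ = h \* (Im \o F)); first exact: measurable_funM.
  by apply/funext => t; rewrite /rmul /=; case: (F t) => ? ? /=; rewrite mul0r addr0.
have le t : rdot (rmul h F) (rmul h F) t <= K ^+ 2 * rdot F F t.
  rewrite (_ : rdot (rmul h F) _ t = h t ^+ 2 * rdot F F t); last first.
    by rewrite /rdot /rmul /=; case: (F t) => ? ? /=; ring.
  rewrite ler_wpM2r ?rdot_ge0// -[h t ^+ 2]real_normK ?num_real//.
  by rewrite ler_sqr ?nnegrE// (le_trans _ (hK t)).
have il : (\int[mu]_t (rdot (rmul h F) (rmul h F) t)%:E <=
    (K ^+ 2)%:E * \int[mu]_t (rdot F F t)%:E)%E.
  rewrite -ge0_integralZl//; first last.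
  - by rewrite lee_fin sqr_ge0.
  - by move=> t _; rewrite lee_fin rdot_ge0.
  - by apply/measurable_EFinP; exact: rdot_measurable.
  apply: ge0_le_integral => //.
  - by move=> t _; rewrite lee_fin rdot_ge0.
  - by apply/measurable_EFinP; exact: rdot_measurable.
  - by apply: measurable_funeM; apply/measurable_EFinP; exact: rdot_measurable.
  - by move=> t _; rewrite -EFinM lee_fin.
have LM : L2 (rmul h F).
  apply/cL2P; split => //; apply: le_lt_trans il _.
  by rewrite -EFin_nrm2// -EFinM ltry.
by split=> //; rewrite -lee_fin EFinM !EFin_nrm2.
Qed.

Lemma rip_rmul (h : T -> R) F G : rip mu (rmul h F) G = rip mu F (rmul h G).
Proof.
apply: eq_Rintegral => t _; rewrite /rdot /rmul.
by case: (F t) (G t) => [? ?] [? ?] /=; ring.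
Qed.

Lemma innerDl F G H : L2 F -> L2 G -> L2 H ->
  inner mu (F \+ G) H = inner mu F H + inner mu G H.
Proof.
move=> LF LG LH; have LiH := L2Z 'i%C LH.
by rewrite !innerE !ripDl.
Qed.

Lemma innerDr F G H : L2 F -> L2 G -> L2 H ->
  inner mu H (F \+ G) = inner mu H F + inner mu H G.
Proof.
move=> LF LG LH; rewrite !innerE ripDr//.
rewrite (_ : (fun t => _) = (fun t => 'i%C * F t) \+ (fun t => 'i%C * G t)).
  by rewrite ripDr//; exact: L2Z.
by apply/funext => t /=; rewrite mulrDr.
Qed.

Lemma innerNl F G : L2 F -> L2 G -> inner mu (\- F) G = - inner mu F G.
Proof.
move=> LF LG; rewrite !innerE.
rewrite (_ : \- F = fun t => (-1)%:C%C * F t).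
  by rewrite !ripZl ?mulN1r//; exact: L2Z.
by apply/funext => t /=; rewrite rmorphN1 mulN1r.
Qed.

Lemma innerNr F G : L2 F -> L2 G -> inner mu F (\- G) = - inner mu F G.
Proof.
move=> LF LG; rewrite !innerE.
have e (H : T -> C) : \- H = fun t => (-1)%:C%C * H t.
  by apply/funext => t /=; rewrite rmorphN1 mulN1r.
rewrite e ripZr// mulN1r.
rewrite (_ : (fun t => 'i%C * _) = \- (fun t => 'i%C * G t)).
  by rewrite e ripZr ?mulN1r//; exact: L2Z.
by apply/funext => t /=; rewrite rmorphN1 mulN1r mulrN.
Qed.

End multiplication.

(** * Polynomials in group elements and bounded functions *)

Section polynomials.
Context (R : realType) d (X : measurableType d) (mu : probability X R).
Context d' (Gam : discreteGroupType d').
Variable rho : pmp_action mu Gam.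
Local Notation C := R[i].
Local Notation Re := (@complex.Re R).
Local Notation Im := (@complex.Im R).
Local Notation GG := (X * Gam)%type.
Local Notation gm := (gmeas mu Gam).
Local Notation L2 := (cLfun gm 2%:E).
Local Notation nrm2 := (l2_sqn gm).
Local Notation rip := (l2_dot gm).
Local Notation op := (op GG R).
Local Notation chi0 := (@chi0 _ X R _ Gam).
Local Notation trace := (@trace _ X R mu _ Gam).
Implicit Types (F G H : GG -> C) (A B Q : op).

Lemma actVK a x : rho (a^-1)%g (rho a x) = x.
Proof. by rewrite -actM mulgV act1. Qed.

Lemma actKV a x : rho a (rho (a^-1)%g x) = x.
Proof. by rewrite -actM mulVg act1. Qed.

(** The edge of [a] has the same second component at every point, so its inverse contributes [a^-1]
    whichever preimage [xget] picks. *)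
Lemma group_opE a F e : group_op rho a F e = F (e.1, (e.2 * a^-1)%g).
Proof.
rewrite /group_op /edge_op mem_set; last first.
  by exists (rho (a^-1)%g (grng rho e)) => //; rewrite /grng /= actKV.
rewrite /gcomp /edge_inv /= /ginv /=.
by congr (F (_, (_ * _)%g)).
Qed.

Definition rmul_op (r : X -> R) : op := mul_op rho (fun x => (r x)%:C%C).

Lemma rmul_opE r F : rmul_op r F = rmul (r \o grng rho) F.
Proof. by []. Qed.

(** Left translation changes the source of an arrow and keeps its range, since
    [rho (a^-1 * g) (rho a x) = rho g x]. Together with [smul], which acts through the source, it
    commutes with the operators below, which act at the range. *)
Definition ltrans (a : Gam) : op := fun F => F \o fibre_map rho (fun=> a) (fun g => (a^-1 * g)%g).

Definition smul (r : X -> R) : op := rmul (r \o gsrc (Gam := Gam)).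

Lemma grng_measurable : measurable_fun setT (grng rho).
Proof. by apply: measurable_slices => g; exact: act_measurable. Qed.

Lemma gsrc_measurable : measurable_fun setT (@gsrc _ X _ Gam).
Proof. exact: measurable_fst. Qed.

(** All members are defined and linear on arbitrary functions, without exceptional null sets, so
    that identities between them can be exact. There is no constructor for adjoints, which are
    determined only up to null sets; [gpoly_adjoint] finds one inside the class. *)
Inductive gpoly : op -> Prop :=
| gpoly_group a : gpoly (group_op rho a)
| gpoly_mul r : bounded_measurable r -> gpoly (rmul_op r)
| gpoly_add A B : gpoly A -> gpoly B -> gpoly (A + B)
| gpoly_opp A : gpoly A -> gpoly (- A)
| gpoly_comp A B : gpoly A -> gpoly B -> gpoly (A \o B).

Lemma group_op_fibre_map a F :
  group_op rho a F = F \o fibre_map rho (fun=> 1%g) (fun g => (g * a^-1)%g).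
Proof. by apply/funext => e; rewrite group_opE /fibre_map /= act1. Qed.

Lemma gpoly_linear A : gpoly A -> forall (c : C) F G,
  A (fun e => c * F e + G e) = (fun e => c * A F e + A G e).
Proof.
elim=> {A}.
- by move=> a c F G; apply/funext => e; rewrite !group_opE.
- by move=> r _ c F G; apply/funext => e; rewrite /rmul_op /mul_op mulrDr mulrCA.
- move=> A B _ hA _ hB c F G; apply/funext => e.
  by rewrite !fctE hA hB mulrDr addrACA.
- by move=> A _ hA c F G; apply/funext => e; rewrite !fctE hA opprD mulrN.
- by move=> A B _ hA _ hB c F G /=; rewrite hB hA.
Qed.

Lemma gpolyD A F G : gpoly A -> A (F \+ G) = A F \+ A G.
Proof.
move=> gA; have := gpoly_linear gA 1 F G.
rewrite (_ : (fun e => 1 * F e + G e) = F \+ G); last first.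
  by apply/funext => e; rewrite mul1r.
by move=> ->; apply/funext => e /=; rewrite mul1r.
Qed.

Lemma gpoly0 A : gpoly A -> A (fun=> 0) = (fun=> 0).
Proof.
move=> gA; have := gpoly_linear gA (-1) (fun=> 0) (fun=> 0).
rewrite (_ : (fun e => -1 * 0 + 0) = (fun=> 0)); last by apply/funext => e; rewrite mulr0 addr0.
by move=> ->; apply/funext => e; rewrite mulN1r addNr.
Qed.

Lemma gpolyZ A c F : gpoly A -> A (fun e => c * F e) = (fun e => c * A F e).
Proof.
move=> gA; have := gpoly_linear gA c F (fun=> 0).
rewrite gpoly0//.
rewrite (_ : (fun e => c * F e + 0) = (fun e => c * F e)); last by apply/funext => e; rewrite addr0.
by move=> ->; apply/funext => e; rewrite addr0.
Qed.

Lemma gpolyN A F : gpoly A -> A (\- F) = \- A F.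
Proof.
move=> gA; have := gpolyZ (-1) F gA.
rewrite (_ : (fun e => -1 * F e) = \- F); last by apply/funext => e; rewrite mulN1r.
by move=> ->; apply/funext => e; rewrite mulN1r.
Qed.

Lemma gpolyB A F G : gpoly A -> A (F \- G) = A F \- A G.
Proof. by move=> gA; rewrite (gpolyD F (\- G) gA) gpolyN. Qed.

Lemma L2_group_op a F : L2 F -> L2 (group_op rho a F).
Proof.
by rewrite group_op_fibre_map; apply: L2_fibre_map; [exact: mulgVK|exact: mulgK].
Qed.

Lemma bounded_measurable_comp (r : X -> R) (f : GG -> X) : measurable_fun setT f ->
  bounded_measurable r -> bounded_measurable (r \o f).
Proof.
move=> mf [mr [K hK]]; split; last by exists K => e; exact: hK.
exact: measurableT_comp.
Qed.

Lemma L2_bounded_rmul (h : GG -> R) F : bounded_measurable h -> L2 F -> L2 (rmul h F).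
Proof. by move=> [mh [K hK]] LF; exact: (L2_rmul mh hK LF).1. Qed.

Lemma gpoly_L2 A : gpoly A -> forall F, L2 F -> L2 (A F).
Proof.
elim=> {A}.
- by move=> a F; exact: L2_group_op.
- move=> r br F LF; rewrite rmul_opE; apply: L2_bounded_rmul => //.
  exact: bounded_measurable_comp grng_measurable br.
- by move=> A B _ hA _ hB F LF; apply: L2D; [exact: hA|exact: hB].
- move=> A _ hA F LF; rewrite (_ : (- A) F = fun e => -1 * A F e); first exact/L2Z/hA.
  by apply/funext => e; rewrite !fctE mulN1r.
- by move=> A B _ hA _ hB F LF; exact/hA/hB.
Qed.

Lemma nrm2D_le F G : L2 F -> L2 G -> nrm2 (F \+ G) <= 2 * nrm2 F + 2 * nrm2 G.
Proof.
move=> LF LG; have := nrm2_ge0 gm (F \- G).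
by rewrite (nrm2D LF LG) (nrm2B LF LG); lra.
Qed.

Lemma gpoly_nrm2 A : gpoly A -> exists2 M : R, 0 <= M & forall F, L2 F -> nrm2 (A F) <= M * nrm2 F.
Proof.
elim=> {A}.
- move=> a; exists 1 => // F LF; rewrite mul1r group_op_fibre_map.
  by rewrite (nrm2_fibre_map rho _ (mulgVK a) (mulgK a)).
- move=> r br; have [mh [K hK]] := bounded_measurable_comp grng_measurable br.
  exists (K ^+ 2); first exact: sqr_ge0.
  by move=> F LF; exact: (L2_rmul mh hK LF).2.
- move=> A B gA [M M0 hM] gB [N N0 hN]; exists (2 * M + 2 * N); first lra.
  move=> F LF; apply: le_trans (nrm2D_le (gpoly_L2 gA LF) (gpoly_L2 gB LF)) _.
  by have := hM F LF; have := hN F LF; lra.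
- move=> A gA [M M0 hM]; exists M => // F LF.
  rewrite (_ : (- A) F = fun e => (-1)%:C%C * A F e); last first.
    by apply/funext => e; rewrite !fctE rmorphN1 mulN1r.
  have LA := gpoly_L2 gA LF.
  rewrite /l2_sqn ripZl//; last exact: L2Z.
  by rewrite ripZr// mulrA mulrNN !mul1r; exact: hM.
- move=> A B gA [M M0 hM] gB [N N0 hN]; exists (M * N); first exact: mulr_ge0.
  move=> F LF; apply: le_trans (hM _ (gpoly_L2 gB LF)) _.
  by rewrite -mulrA ler_wpM2l// hN.
Qed.

Lemma gpoly_bounded A : gpoly A -> bounded_op gm A.
Proof.
move=> gA; apply: nrm2_bounded_op; first exact: gpoly_L2.
- by move=> c F G _ _; rewrite gpoly_linear//; exact: aeW.
- by have [M _ hM] := gpoly_nrm2 gA; exists M.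
Qed.

(** The imaginary part is the real identity at ['i * G], because [B] is complex linear. *)
Lemma inner_of_rip A B F G : gpoly B ->
  (forall G', L2 G' -> rip (A F) G' = rip F (B G')) -> L2 G ->
  inner gm (A F) G = inner gm F (B G).
Proof.
move=> gB h LG; rewrite !innerE !h//; last exact: L2Z.
by rewrite gpolyZ.
Qed.

Lemma rip_group_op a F G : L2 F -> L2 G ->
  rip (group_op rho a F) G = rip F (group_op rho a^-1%g G).
Proof.
move=> LF LG; rewrite !group_op_fibre_map.
have ca : cancel (fun g : Gam => (g * a^-1)%g) (fun g => (g * a)%g) by exact: mulgVK.
have cb : cancel (fun g : Gam => (g * a)%g) (fun g => (g * a^-1)%g) by exact: mulgK.
have LG' := L2_fibre_map rho (fun=> 1%g) cb ca LG.
rewrite -[RHS](rip_fibre_map rho (fun=> 1%g) ca cb)//; last by rewrite invgK.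
congr (l2_dot _ _ _); apply/funext => -[x g] /=.
by rewrite /fibre_map /= !act1 invgK mulgVK.
Qed.

Lemma rip_rmul_op r F G : rip (rmul_op r F) G = rip F (rmul_op r G).
Proof. by rewrite !rmul_opE rip_rmul. Qed.

Lemma gpoly_adjoint A : gpoly A -> exists2 B, gpoly B &
  forall F G, L2 F -> L2 G -> inner gm (A F) G = inner gm F (B G).
Proof.
elim=> {A}.
- move=> a; exists (group_op rho a^-1%g); first exact: gpoly_group.
  move=> F G LF LG; apply: inner_of_rip => //; first exact: gpoly_group.
  by move=> G' LG'; rewrite rip_group_op.
- move=> r br; exists (rmul_op r); first exact: gpoly_mul.
  move=> F G LF LG; apply: inner_of_rip => //; first exact: gpoly_mul.
  by move=> G' LG'; rewrite rip_rmul_op.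
- move=> A A' gA [B gB hB] gA' [B' gB' hB']; exists (B + B'); first exact: gpoly_add.
  move=> F G LF LG.
  rewrite -[(A + A') F]/(A F \+ A' F) -[(B + B') G]/(B G \+ B' G).
  rewrite innerDl//; [|exact: gpoly_L2 LF|exact: gpoly_L2 LF].
  rewrite innerDr//; [|exact: gpoly_L2 LG|exact: gpoly_L2 LG].
  by rewrite hB// hB'.
- move=> A gA [B gB hB]; exists (- B); first exact: gpoly_opp.
  move=> F G LF LG.
  rewrite -[(- A) F]/(\- A F) -[(- B) G]/(\- B G).
  rewrite innerNl//; last exact: gpoly_L2 LF.
  rewrite innerNr//; last exact: gpoly_L2 LG.
  by rewrite hB.
- move=> A A' gA [B gB hB] gA' [B' gB' hB']; exists (B' \o B); first exact: gpoly_comp.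
  move=> F G LF LG /=.
  by rewrite hB ?hB'//; [exact: gpoly_L2 LG|exact: gpoly_L2 LF].
Qed.

Lemma gpoly_is_adjoint A : gpoly A -> exists B, is_adjoint gm A B.
Proof.
move=> gA; have [B gB hB] := gpoly_adjoint gA.
by exists B; split; [exact: gpoly_bounded|exact: hB].
Qed.

Lemma gpoly_groupoid_ring A : gpoly A -> groupoid_ring rho A.
Proof.
elim=> {A}.
- move=> a; apply: GR_edge; split => //.
  by move=> x y _ _ /= h; rewrite -(actVK a x) -(actVK a y); congr (rho _ _).
- move=> r [mr [K hK]]; apply: GR_mul.
  have Linfty (h : X -> R) : measurable_fun setT h -> (forall x, `|h x| <= K) ->
      h \in Lfun mu +oo%E.
    move=> mh hK'; rewrite inE; apply/andP; split; rewrite inE//=.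
    rewrite /finite_norm unlock /Lnorm; case: ifPn => // _.
    apply: (@le_lt_trans _ _ K%:E); last exact: ltry.
    by apply: ess_sup_ler => x /=; rewrite lee_fin; exact: hK'.
  split; first by apply: Linfty.
  by apply: (Linfty (fun=> 0)) => // x; rewrite normr0; exact: le_trans (normr_ge0 _) (hK x).
- by move=> A B _ hA _ hB; exact: GR_add.
- by move=> A _ hA; exact: GR_opp.
- by move=> A B _ hA _ hB; exact: GR_comp.
Qed.

End polynomials.

(** * Left invariance and the trace property *)

Section tracial.
Context (R : realType) d (X : measurableType d) (mu : probability X R).
Context d' (Gam : discreteGroupType d').
Variable rho : pmp_action mu Gam.
Local Notation C := R[i].
Local Notation Re := (@complex.Re R).
Local Notation Im := (@complex.Im R).
Local Notation GG := (X * Gam)%type.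
Local Notation gm := (gmeas mu Gam).
Local Notation L2 := (cLfun gm 2%:E).
Local Notation rip := (l2_dot gm).
Local Notation op := (op GG R).
Local Notation chi0 := (@chi0 _ X R _ Gam).
Local Notation trace := (@trace _ X R mu _ Gam).
Local Notation ltrans := (ltrans rho).
Local Notation smul := (@smul R _ X _ Gam).
Implicit Types (F G H : GG -> C) (A B Q : op).

(* The projection onto the kernel of [S] lies only in the weak closure of the
   groupoid ring; commuting with left translations and with functions of the
   source is all that the trace property needs of one of the two factors. *)
Definition left_invariant B :=
  [/\ bounded_op gm B,
      forall a F, L2 F -> B (ltrans a F) = ltrans a (B F) %[ae gm] &
      forall r F, bounded_measurable r -> L2 F -> B (smul r F) = smul r (B F) %[ae gm]].

Lemma ltrans_cancel (a : Gam) : cancel (fun g => (a^-1 * g)%g) (fun g => (a * g)%g).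
Proof. exact: mulVKg. Qed.

Lemma ltrans_cancelV (a : Gam) : cancel (fun g => (a * g)%g) (fun g => (a^-1 * g)%g).
Proof. exact: mulKg. Qed.

Lemma L2_ltrans a F : L2 F -> L2 (ltrans a F).
Proof. exact: (L2_fibre_map rho _ (@ltrans_cancel a) (@ltrans_cancelV a)). Qed.

Lemma ltransK a F : ltrans a^-1%g (ltrans a F) = F.
Proof.
apply/funext => -[x g]; rewrite /ltrans /fibre_map /=.
by rewrite actKV mulgA invgK mulVg mul1g.
Qed.

Lemma rip_ltrans a F G : L2 F -> L2 G -> rip (ltrans a F) G = rip F (ltrans a^-1%g G).
Proof.
move=> LF LG; have LG' := L2_ltrans a^-1%g LG.
rewrite -[RHS](rip_fibre_map rho (fun=> a) (@ltrans_cancel a) (@ltrans_cancelV a))//.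
rewrite -/(ltrans a F) -/(ltrans a (ltrans a^-1%g G)).
by have := ltransK a^-1%g G; rewrite invgK => ->.
Qed.

Lemma inner_ltrans a F G : L2 F -> L2 G ->
  inner gm (ltrans a F) G = inner gm F (ltrans a^-1%g G).
Proof.
move=> LF LG; rewrite !innerE !rip_ltrans//; last exact: L2Z.
Qed.

Lemma L2_smul r F : bounded_measurable r -> L2 F -> L2 (smul r F).
Proof.
move=> br; apply: L2_bounded_rmul.
by apply: bounded_measurable_comp br; exact: gsrc_measurable.
Qed.

Lemma gpoly_left_invariant A : gpoly rho A -> left_invariant A.
Proof.
move=> gA; split; first exact: gpoly_bounded gA.
- move=> a F _; suff -> : A (ltrans a F) = ltrans a (A F) by exact: aeW.
  elim: gA F => {A}.
  + by move=> b F; apply/funext => e; rewrite /ltrans /= !group_opE /fibre_map /= mulgA.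
  + move=> r _ F; apply/funext => -[x g]; rewrite /ltrans /= /rmul_op /mul_op.
    by congr (_ * _); rewrite /grng /fibre_map /= -actM mulVKg.
  + by move=> A B _ hA _ hB F; apply/funext => e; rewrite !fctE hA hB.
  + by move=> A _ hA F; apply/funext => e; rewrite !fctE hA.
  + by move=> A B _ hA _ hB F /=; rewrite hB hA.
- move=> r F _ _; suff -> : A (smul r F) = smul r (A F) by exact: aeW.
  elim: gA F => {A}.
  + by move=> b F; apply/funext => e; rewrite /smul /rmul /= !group_opE.
  + by move=> s _ F; apply/funext => e; rewrite /smul /rmul /rmul_op /mul_op /= mulrCA.
  + by move=> A B _ hA _ hB F; apply/funext => e; rewrite !fctE hA hB /smul /rmul mulrDr.
  + by move=> A _ hA F; apply/funext => e; rewrite !fctE hA /smul /rmul mulrN.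
  + by move=> A B _ hA _ hB F /=; rewrite hB hA.
Qed.

Lemma bounded_op_comp A B : bounded_op gm A -> bounded_op gm B -> bounded_op gm (A \o B).
Proof.
move=> bA bB; have [LA lA _] := bA; have [LB lB _] := bB.
apply: nrm2_bounded_op.
- by move=> F /LB /LA.
- move=> c F G LF LG.
  have h : A (B (fun t => c * F t + G t)) = A (fun t => c * B F t + B G t) %[ae gm].
    apply: bounded_op_ae => //; last exact: lB.
      by apply: LB; apply: L2D => //; exact: L2Z.
    by apply: L2D; [apply: L2Z|]; exact: LB.
  by apply: ae_eq_trans h _; apply: lA; exact: LB.
- have [M M0 hM] := bounded_op_nrm2 bA; have [N _ hN] := bounded_op_nrm2 bB.
  exists (M * N) => F LF; apply: le_trans (hM _ (LB _ LF)) _.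
  by rewrite -mulrA ler_wpM2l// hN.
Qed.

Lemma left_invariant_comp A B : left_invariant A -> left_invariant B ->
  left_invariant (A \o B).
Proof.
move=> [bA tA sA] [bB tB sB]; split; first exact: bounded_op_comp.
- move=> a F LF; have LB := bB; case: LB => LB _ _.
  have h : A (B (ltrans a F)) = A (ltrans a (B F)) %[ae gm].
    by apply: bounded_op_ae => //; [exact/LB/L2_ltrans|exact/L2_ltrans/LB|exact: tB].
  by apply: ae_eq_trans h _; apply: tA; exact: LB.
- move=> r F br LF; have LB := bB; case: LB => LB _ _.
  have h : A (B (smul r F)) = A (smul r (B F)) %[ae gm].
    by apply: bounded_op_ae => //; [exact/LB/L2_smul|exact/L2_smul/LB|exact: sB].
  by apply: ae_eq_trans h _; apply: sA => //; exact: LB.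
Qed.

Lemma chi0E e : chi0 e = (e.2 == 1%g)%:R.
Proof. by rewrite /Defs.chi0 indicE; congr (nat_of_bool _)%:R; apply/idP/eqP; rewrite inE. Qed.

Lemma unit_measurable (U : set X) : measurable U -> measurable (U `*` [set (1%g : Gam)]).
Proof. by move=> mU; apply: measurableX => //; exact: measurable_discrete. Qed.

Lemma gmeas_unit (U : set X) : measurable U -> gm (U `*` [set 1%g]) = mu U.
Proof.
move=> mU; rewrite gmeas_rect// /counting asboolT//.
by rewrite fset_set1 finmap.cardfs1 mule1.
Qed.

Lemma L2_indic (B : set GG) : measurable B -> (gm B < +oo)%E -> L2 (\1_B : GG -> C).
Proof.
move=> mB fB.
have eR : Re \o \1_B = \1_B :> (GG -> R).
  by apply/funext => e; rewrite /= !indicE; case: (e \in B).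
have eI : Im \o (\1_B : GG -> C) = cst 0.
  by apply/funext => e; rewrite /= !indicE; case: (e \in B).
apply/cL2P; split.
- by rewrite eR; exact: measurable_indic.
- by rewrite eI; exact: measurable_cst.
- rewrite (_ : (\int[gm]_t _)%E = (\int[gm]_e (\1_B e)%:E)%E).
    by rewrite integral_indic// setIT.
  apply: eq_integral => e _; congr (_%:E).
  by rewrite /rdot -![Re _]/((Re \o _) e) -![Im _]/((Im \o _) e) eR eI /= mulr0 addr0
    indicE -natrM mulnb andbb.
Qed.

Lemma chi0_rect : [set e : GG | e.2 = 1%g] = setT `*` [set 1%g].
Proof. by apply/seteqP; split => e //= [_ ?]. Qed.

Lemma L2_chi0 : L2 chi0.
Proof.
rewrite /Defs.chi0 chi0_rect; apply: L2_indic; first exact: unit_measurable.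
by rewrite gmeas_unit// probability_setT ltry.
Qed.

Lemma trace_indic (U : set X) : measurable U -> trace (rmul_op rho \1_U) = (fine (mu U))%:C%C.
Proof.
move=> mU; rewrite /Defs.trace innerE.
have e0 e : rmul_op rho \1_U chi0 e = (e \in U `*` [set (1%g : Gam)])%:R.
  rewrite /rmul_op /mul_op chi0E /grng; case: eqP => [e1|e1].
    rewrite e1 act1 mulr1 indicE.
    have -> : (e \in U `*` [set 1%g]) = (e.1 \in U).
      by apply/idP/idP; rewrite !inE; [case|split].
    by rewrite rmorph_nat.
  by rewrite mulr0 memNset// => -[_ /=].
have e1 e : rdot (rmul_op rho \1_U chi0) chi0 e = \1_(U `*` [set (1%g : Gam)]) e.
  rewrite /rdot e0 chi0E indicE.
  have [|] := boolP (e \in _); last by rewrite !mul0r addr0.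
  by rewrite inE => -[_ /= ->]; rewrite eqxx !mulr1 mulr0 addr0.
have e2 e : rdot (rmul_op rho \1_U chi0) (fun t => 'i%C * chi0 t) e = 0.
  rewrite /rdot e0 chi0E; case: (e \in _) => /=; last by rewrite !mul0r addr0.
  by case: eqP => _ /=; rewrite ?(mulr0, mul0r, mulr1, mul1r, subrr, addr0, subr0).
congr Complex.
- rewrite /l2_dot (eq_Rintegral _ _ (g := \1_(U `*` [set (1%g : Gam)]))) => [|e _]; last exact: e1.
  rewrite /Rintegral integral_indic//; last exact: unit_measurable.
  by rewrite setIT gmeas_unit.
- rewrite /l2_dot (eq_Rintegral _ _ (g := fun=> 0)) => [|e _]; last exact: e2.
  by rewrite /Rintegral integral0.
Qed.

(** On [chi0] a generator acts equally well from the other side: a group element as a left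
    translation, a function as a function of the source. Move the generator to the second argument
    by its adjoint, switch sides there, move it back, and commute it with [B]. For a product the two
    factors go round one after the other, which uses that left invariant operators are closed under
    composition. *)
Lemma trace_cyclic A B : gpoly rho A -> left_invariant B -> trace (A \o B) = trace (B \o A).
Proof.
move=> gA; elim: gA B => {A}.
- move=> a B [bB tB _]; have [LB _ _] := bB; rewrite /Defs.trace /=.
  have ch b : group_op rho b chi0 = ltrans b chi0.
    apply/funext => e; rewrite group_opE /ltrans /= !chi0E /fibre_map /=.
    by rewrite -(inj_eq (mulgI b^-1%g)) -(inj_eq (mulIg b)) mulgA mulgVK mulg1 mulVg.
  have L2c := L2_chi0.
  rewrite (_ : inner gm (group_op rho a (B chi0)) chi0 =
               inner gm (B chi0) (group_op rho a^-1%g chi0)); last first.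
    apply: inner_of_rip => //; first exact: gpoly_group.
    by move=> G LG; rewrite rip_group_op//; exact: LB.
  rewrite !ch -inner_ltrans//; last exact: LB.
  apply/esym/ae_eq_inner => //; last exact: tB.
    exact/LB/L2_ltrans.
  exact/L2_ltrans/LB.
- move=> r br B [bB _ sB]; have [LB _ _] := bB; rewrite /Defs.trace /=.
  have L2c := L2_chi0.
  have ch : rmul_op rho r chi0 = smul r chi0.
    apply/funext => e; rewrite /rmul_op /mul_op /smul /rmul chi0E /grng /gsrc /=.
    by case: eqP => [->|_]; [rewrite act1|rewrite !mulr0].
  have adj F G : L2 F -> L2 G -> inner gm (rmul_op rho r F) G = inner gm F (rmul_op rho r G).
    move=> LF LG; apply: inner_of_rip => //; first exact: gpoly_mul.
    by move=> G' LG'; rewrite rip_rmul_op.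
  rewrite adj//; last exact: LB.
  rewrite !ch.
  have -> : inner gm (B chi0) (smul r chi0) = inner gm (smul r (B chi0)) chi0.
    rewrite !innerE !rip_rmul; congr Complex; congr (l2_dot _ _ _).
    by apply/funext => e; rewrite /smul /rmul mulrCA.
  apply/esym/ae_eq_inner => //; last exact: sB.
    exact/LB/L2_smul.
  exact/L2_smul/LB.
- move=> A A' gA hA gA' hA' B iB; have [bB _ _] := iB; have [LB lB _] := bB.
  have L2c := L2_chi0; have LA := gpoly_L2 gA L2c; have LA' := gpoly_L2 gA' L2c.
  have := hA B iB; have := hA' B iB; rewrite /Defs.trace /= => h1 h2.
  rewrite -[(A + A') (B chi0)]/(A (B chi0) \+ A' (B chi0)).
rewrite innerDl//; [|by apply: (gpoly_L2 gA); exact: LB|by apply: (gpoly_L2 gA'); exact: LB].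
  rewrite h1 h2 -innerDl//; [|exact: LB|exact: LB].
  rewrite -[(A + A') chi0]/(A chi0 \+ A' chi0).
  apply/esym/ae_eq_inner => //; [exact/LB/L2D|by apply: L2D; exact: LB|].
  have := lB 1 (A chi0) (A' chi0) LA LA'.
  rewrite (_ : (fun t => _ + _) = A chi0 \+ A' chi0); last first.
    by apply/funext => t; rewrite mul1r.
  by move=> h; apply: ae_eq_trans h _; apply: aeW => t _ /=; rewrite mul1r.
- move=> A gA hA B iB; have [bB _ _] := iB; have [LB lB _] := bB.
  have L2c := L2_chi0; have LA := gpoly_L2 gA L2c.
  have := hA B iB; rewrite /Defs.trace /= => h1.
  rewrite -[(- A) (B chi0)]/(\- A (B chi0)) -[(- A) chi0]/(\- A chi0).
  rewrite innerNl//; last by apply: (gpoly_L2 gA); exact: LB.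
  rewrite h1 -innerNl//; last exact: LB.
  have LNA (F : GG -> C) : L2 F -> L2 (\- F).
    move=> LF; rewrite (_ : \- F = fun e => -1 * F e); first exact: L2Z.
    by apply/funext => e /=; rewrite mulN1r.
  apply/esym/ae_eq_inner => //; [exact/LB/LNA|exact/LNA/LB|].
  (* Linearity is given in the form [c * F + G]; negation is [-2 * F + F]. *)
  have := lB (-2) (A chi0) (A chi0) LA LA.
  rewrite (_ : (fun t => _ + _) = \- A chi0); last first.
    by apply/funext => t /=; ring.
  by move=> h; apply: ae_eq_trans h _; apply: aeW => t _ /=; ring.
- move=> A A' gA hA gA' hA' B iB.
  have iA := gpoly_left_invariant gA; have iA' := gpoly_left_invariant gA'.
  have h1 := hA _ (left_invariant_comp iA' iB).
  have h2 := hA' _ (left_invariant_comp iB iA).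
  by rewrite -[LHS]/(trace (A \o (A' \o B))) h1 -[LHS]/(trace (A' \o (B \o A))) h2.
Qed.

(** [V] is stable under [ltrans a^-1], the adjoint of [ltrans a], and under the self-adjoint
    [smul r]. Hence its orthogonal complement is stable as well, and uniqueness of the projection
    gives the commutation. *)
Lemma orth_proj_left_invariant V Q : closed_subspace gm V ->
  (forall a F, V F -> V (ltrans a F)) ->
  (forall r F, bounded_measurable r -> V F -> V (smul r F)) ->
  is_orth_proj gm V Q -> left_invariant Q.
Proof.
move=> cV tV sV [bQ hQ]; have [VL _ _ _] := cV.
have hQ' F : L2 F -> V (Q F) /\ forall G, V G -> rip (F \- Q F) G = 0.
  move=> /hQ[VQ h]; split => // G VG; have := h G VG.
  by rewrite -Re_inner => ->.
split => //.
- move=> a F LF; have [VQ oQ] := hQ' _ LF; have LQ := VL _ VQ.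
  have [VQ' oQ'] := hQ' _ (L2_ltrans a LF).
  apply: (proj_unique cV (L2_ltrans a LF)) => //; first exact: tV.
  move=> G VG; rewrite -[X in rip X _]/(ltrans a (F \- Q F)).
  by rewrite rip_ltrans//; [rewrite oQ//; exact: tV|exact: L2B|exact: VL].
- move=> r F br LF; have [VQ oQ] := hQ' _ LF; have LQ := VL _ VQ.
  have [VQ' oQ'] := hQ' _ (L2_smul br LF).
  apply: (proj_unique cV (L2_smul br LF)) => //; first exact: sV.
  move=> G VG; rewrite (_ : _ \- _ = smul r (F \- Q F)); last first.
    by apply/funext => e; rewrite /smul /rmul /= mulrBr.
  by rewrite rip_rmul oQ//; exact: sV.
Qed.

End tracial.

(** * Turing dynamics *)

Section dynamics.
Context (R : realType) d (X : measurableType d) (mu : probability X R).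
Context d' (Gam : discreteGroupType d').
Variable rho : pmp_action mu Gam.
Context n (M : turing_system X Gam n).
Local Notation T := (turing_map rho M).
Local Notation halt := (acc M `|` rej M).

Lemma ex_piece x : exists i, piece M i x.
Proof.
have [i _ hi] : (\bigcup_i piece M i) x by rewrite piece_cover.
by exists i.
Qed.

Lemma piece_inj i j x : piece M i x -> piece M j x -> i = j.
Proof.
by move=> hi hj; apply: (piece_disjoint (t := M)) => //; exists x.
Qed.

Lemma turing_mapE i x : piece M i x -> T x = rho (elt M i) x.
Proof.
move=> hi; rewrite /turing_map; case: pickP => [j|/(_ i)].
  by rewrite inE => hj; rewrite (piece_inj hi hj).
by rewrite mem_set.
Qed.

Lemma halt_piece i x : piece M i x -> halt x -> piece M i `<=` halt.
Proof.
move=> hi []; [have [J e] := acc_pieces M|have [J e] := rej_pieces M];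
  rewrite e => -[j Jj hj]; rewrite (piece_inj hi hj) => y hy;
  [left|right]; by exists j.
Qed.

Lemma halt_elt i x : piece M i x -> halt x -> elt M i = 1%g.
Proof.
move=> hi hx; apply: elt_halt => y hy.
by have [] := halt_piece hi hx hy; [right|left].
Qed.

Lemma halt_fixed x : halt x -> T x = x.
Proof.
by move=> hx; have [i hi] := ex_piece x; rewrite (turing_mapE hi) (halt_elt hi hx) act1.
Qed.

Lemma iter_fixed k x : T x = x -> iter k T x = x.
Proof. by move=> e; elim: k => //= k ->. Qed.

Lemma halt_iter_le j k x : (j <= k)%N -> halt (iter j T x) -> iter k T x = iter j T x.
Proof.
by move=> jk h; rewrite -(subnK jk) iterD iter_fixed// halt_fixed.
Qed.

Lemma iter_orbit k x : exists g, iter k T x = rho g x.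
Proof.
elim: k => [|k [g e]]; first by exists 1%g; rewrite act1.
have [i hi] := ex_piece (iter k T x).
by exists (g * elt M i)%g; rewrite iterS (turing_mapE hi) actM -e.
Qed.

Lemma pieces_measurable (J : set 'I_n) : measurable (\bigcup_(i in J) piece M i).
Proof.
by apply: fin_bigcup_measurable => [|i _]; [exact: finite_finset|exact: piece_measurable].
Qed.

Lemma init_measurable : measurable (init M).
Proof. by have [J ->] := init_pieces M; exact: pieces_measurable. Qed.

Lemma acc_measurable : measurable (acc M).
Proof. by have [J ->] := acc_pieces M; exact: pieces_measurable. Qed.

Lemma rej_measurable : measurable (rej M).
Proof. by have [J ->] := rej_pieces M; exact: pieces_measurable. Qed.

Lemma halt_measurable : measurable halt.
Proof. by apply: measurableU; [exact: acc_measurable|exact: rej_measurable]. Qed.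

Lemma act_preimage_measurable g (U : set X) : measurable U -> measurable (rho g @^-1` U).
Proof. by move=> mU; rewrite -[X in measurable X]setTI; exact: act_measurable. Qed.

Lemma turing_map_preimage_measurable (U : set X) : measurable U -> measurable (T @^-1` U).
Proof.
move=> mU.
rewrite (_ : T @^-1` U = \bigcup_i (piece M i `&` rho (elt M i) @^-1` U)).
  apply: fin_bigcup_measurable => [|i _]; first exact: finite_finset.
  by apply: measurableI; [exact: piece_measurable|exact: act_preimage_measurable].
apply/seteqP; split => [x /= hx|x [i _ [hi /= hx]]].
- by have [i hi] := ex_piece x; exists i => //; split => //=; rewrite -(turing_mapE hi).
- by rewrite /= (turing_mapE hi).
Qed.

Lemma iter_preimage_measurable k (U : set X) : measurable U ->
  measurable (iter k T @^-1` U).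
Proof.
elim: k U => // k IH U mU.
have -> : iter k.+1 T @^-1` U = iter k T @^-1` (T @^-1` U) by [].
by apply: IH; exact: turing_map_preimage_measurable.
Qed.

(** Images under [T] are finite unions of preimages under group elements; this yields both their
    measurability and the bound on their measure. *)
Lemma turing_imageE (U : set X) :
  T @` U = \bigcup_i (rho (elt M i)^-1%g @^-1` (U `&` piece M i)).
Proof.
apply/seteqP; split => [_ [x Ux <-]|y [i _ [/= Ux hi]]].
- have [i hi] := ex_piece x; exists i => //=.
  by rewrite (turing_mapE hi) actVK.
- by exists (rho (elt M i)^-1%g y) => //; rewrite (turing_mapE hi) actKV.
Qed.

Lemma turing_image_measurable (U : set X) : measurable U -> measurable (T @` U).
Proof.
move=> mU; rewrite turing_imageE.
apply: fin_bigcup_measurable => [|i _]; first exact: finite_finset.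
by apply: act_preimage_measurable; apply: measurableI => //; exact: piece_measurable.
Qed.

Lemma iter_image_measurable k (U : set X) : measurable U -> measurable (iter k T @` U).
Proof.
elim: k U => [|k IH] U mU; first by rewrite (_ : iter 0 T = id)// image_id.
rewrite (_ : iter k.+1 T @` U = T @` (iter k T @` U)); last by rewrite image_comp.
exact/turing_image_measurable/IH.
Qed.

(* [T] moves each piece by a measure preserving map, so images can only lose
   measure through overlaps. *)
Lemma turing_image_le (U : set X) : measurable U -> (mu (T @` U) <= mu U)%E.
Proof.
move=> mU; have mI i : measurable (U `&` piece M i).
  by apply: measurableI => //; exact: piece_measurable.
have -> : mu U = (\sum_(i \in [set: 'I_n]) mu (U `&` piece M i))%E.
  rewrite -measure_fin_bigcup//; first by rewrite -setI_bigcupr piece_cover setIT.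
    exact: finite_finset.
  by move=> i j _ _ [x [[_ hi] [_ hj]]]; exact: piece_inj hi hj.
apply: (@le_trans _ _ (\sum_(i \in [set: 'I_n])
    mu (rho (elt M i)^-1%g @^-1` (U `&` piece M i)))%E).
  apply: content_sub_fsum.
  - exact: finite_finset.
  - by move=> i _; exact: act_preimage_measurable.
  - exact: turing_image_measurable.
  - by rewrite turing_imageE.
- rewrite le_eqVlt; apply/orP; left; apply/eqP; apply: eq_fsbigr => i _.
  exact: act_measure_preserving.
Qed.

Lemma iter_image_le k (U : set X) : measurable U -> (mu (iter k T @` U) <= mu U)%E.
Proof.
elim: k U => [|k IH] U mU; first by rewrite (_ : iter 0 T = id)// image_id.
rewrite (_ : iter k.+1 T @` U = T @` (iter k T @` U)); last by rewrite image_comp.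
by apply: le_trans (turing_image_le _) (IH _ mU); exact: iter_image_measurable.
Qed.

Lemma acc_fixed_lim x y : acc M y -> (exists k, iter k T x = y) -> turing_lim rho M x y.
Proof.
move=> ay [k e]; exists k; split => //=.
by rewrite e halt_fixed//; left.
Qed.

Lemma turing_lim_unique x y z : turing_lim rho M x y -> turing_lim rho M x z -> y = z.
Proof.
move=> [k [hk ->]] [l [hl ->]].
have [kl|lk] := leqP k l.
  by rewrite -[in RHS](subnK kl) iterD [RHS]iter_fixed//; exact: esym hk.
by rewrite -[in LHS](subnK (ltnW lk)) iterD [LHS]iter_fixed//; exact: esym hl.
Qed.

Lemma fund2P s : fund2 rho M s <->
  acc M s /\ exists k x, [/\ init M x, ~ (exists y, T y = x) & iter k T x = s].
Proof.
split.
- move=> [x [[ix [y [xy ay]] nx] xs]].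
  rewrite -(turing_lim_unique xy xs); split => //.
  by have [k [_ e]] := xy; exists k, x; split.
- move=> [as_ [k [x [ix nx e]]]]; exists x.
  have xs : turing_lim rho M x s by apply: acc_fixed_lim => //; exists k.
  by split => //; split => //; exists s.
Qed.

Lemma range_measurable : measurable (range T).
Proof. exact: turing_image_measurable. Qed.

Lemma fund2_measurable : measurable (fund2 rho M).
Proof.
rewrite (_ : fund2 rho M = acc M `&` \bigcup_k (iter k T @` (init M `\` range T))).
  apply: measurableI; first exact: acc_measurable.
  apply: bigcupT_measurable => k; apply: iter_image_measurable.
  by apply: measurableD; [exact: init_measurable|exact: range_measurable].
apply/seteqP; split => s.
- move=> /fund2P[as_ [k [x [ix nx e]]]]; split => //; exists k => //; exists x => //.
  by split => // -[y _ yx]; apply: nx; exists y.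
- move=> [as_ [k _ [x [ix nx] e]]]; apply/fund2P; split => //; exists k, x; split => //.
  by move=> [y yx]; apply: nx; exists y.
Qed.

(** * Invariant sets with a uniform halting time *)

Hypothesis stops : stops_on_any_configuration rho M.
Hypothesis norestart : does_not_restart rho M.

(* A conull subset, invariant under all of [Gam], on which the two almost
   everywhere hypotheses hold pointwise. *)
Lemma regular_set : exists Y : set X, [/\ measurable Y, mu (~` Y) = 0%E,
  forall g x, Y (rho g x) <-> Y x,
  forall x, Y x -> exists k, halt (iter k T x) &
  forall x y, Y x -> init M x -> T y <> x].
Proof.
have [N [mN N0 sN]] := stops.
pose N' := N `|` (range T `&` init M).
have mRI : measurable (range T `&` init M).
  by apply: measurableI; [exact: range_measurable|exact: init_measurable].
have mN' : measurable N' by exact: measurableU.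
have N'0 : mu N' = 0%E.
  apply/eqP; rewrite eq_le measure_ge0 andbT.
  have e1 : mu (range T `&` init M) = 0%E := norestart.
  apply: (@le_trans _ _ (mu N + mu (range T `&` init M))%E); first exact: measureU2.
  by rewrite (N0 : mu N = 0%E) e1 adde0.
have cov (g : Gam) : mu (rho g @^-1` N') = 0%E by rewrite act_measure_preserving.
pose Y := ~` \bigcup_g (rho g @^-1` N').
have mcup : measurable (\bigcup_g (rho g @^-1` N')).
  apply: countable_bigcupT_measurable; first exact: countableP.
  by move=> g; exact: act_preimage_measurable.
have YN x : Y x -> ~ N' x by move=> h Nx; apply: h; exists 1%g => //=; rewrite act1.
have Yg g x : Y x -> Y (rho g x).
  by move=> h [k _ /= hk]; apply: h; exists (g * k)%g => //=; rewrite actM.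
exists Y; split.
- exact: measurableC.
- rewrite setCK.
  rewrite (_ : \bigcup_g (rho g @^-1` N') =
      \bigcup_k (if unpickle k is Some g then rho g @^-1` N' else set0)).
    apply/eqP; rewrite eq_le measure_ge0 andbT.
    apply: le_trans (generalized_Boole_inequality mu _ _) _.
    + by move=> k; case: (unpickle k) => // g; exact: act_preimage_measurable.
    + apply: bigcupT_measurable => k; case: (unpickle k) => // g.
      exact: act_preimage_measurable.
    + rewrite (eq_eseriesr (g := fun=> 0%E)); first by rewrite eseries0.
      by move=> k _; case: (unpickle k) => [g|]; [exact: cov|exact: measure0].
  apply/seteqP; split => x.
  + by move=> [g _ h]; exists (pickle g) => //; rewrite pickleK.
  + by move=> [k _]; case: (unpickle k) => // g h; exists g.
- by move=> g x; split; [move=> /(Yg g^-1%g); rewrite actVK|exact: Yg].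
- move=> x /YN h; have : ~ N x by move=> Nx; apply: h; left.
  move=> nN; have : exists y, turing_lim rho M x y /\ halt y.
    by apply: contrapT => h'; apply: nN; exact: sN.
  by move=> [y [[k [_ ->]] hy]]; exists k.
- by move=> x y /YN h ix e; apply: h; right; split => //; exists y.
Qed.

(* [B N] discards the basins of the sinks that are reached in more than [N]
   steps; [Z N] is the set of these sinks. *)
Lemma good_sets : exists B : nat -> set X, [/\ forall N, measurable (B N),
  forall N x, B N (T x) <-> B N x,
  forall N x, B N x -> halt (iter N T x),
  forall N x y, B N x -> init M x -> T y <> x &
  (fun N => mu (~` B N)) @ \oo --> 0%E].
Proof.
have [Y [mY Y0 Yg Yh Yi]] := regular_set.
pose V N := ~` (iter N T @^-1` halt).
pose Z N := halt `&` (iter N.+1 T @` V N).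
pose Bad N := \bigcup_a (iter a T @^-1` Z N).
have mV N : measurable (V N).
  by apply: measurableC; apply: iter_preimage_measurable; exact: halt_measurable.
have mZ N : measurable (Z N).
  by apply: measurableI; [exact: halt_measurable|exact: iter_image_measurable].
have mBad N : measurable (Bad N).
  by apply: bigcupT_measurable => a; exact: iter_preimage_measurable.
have YT k x : Y (iter k T x) <-> Y x by have [g ->] := iter_orbit k x; exact: Yg.
have ndZ N : Z N.+1 `<=` Z N.
  move=> s [hs [x Vx e]]; split => //; exists (T x); last by rewrite -iterSr.
  by rewrite /V /= -iterSr.
have ndZ' N K : (N <= K)%N -> Z K `<=` Z N.
  move=> /subnK <-; elim: (K - N)%N => // k IH; rewrite addSn.
  exact: subset_trans (ndZ _) IH.
have V0 : (fun N => mu (V N `&` Y)) @ \oo --> 0%E.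
  rewrite (_ : 0%E = mu (\bigcap_N (V N `&` Y))); last first.
    rewrite (_ : \bigcap_N _ = set0) ?measure0// -subset0 => x h.
    have [_ Yx] := h 0%N I; have [k hk] := Yh x Yx.
    by have [] := h k I.
  apply: nonincreasing_cvg_mu.
  - exact: le_lt_trans (probability_le1 mu (measurableI _ _ (mV 0%N) mY)) (ltry _).
  - by move=> N; exact: measurableI.
  - by apply: bigcapT_measurable => N; exact: measurableI.
  - move=> N K NK; apply/subsetPset => x [Vx Yx]; split => // h; apply: Vx.
    by rewrite /= (halt_iter_le NK).
pose ZZ := \bigcap_N Z N.
have mZZ : measurable ZZ by exact: bigcapT_measurable.
have ZZ0 : mu ZZ = 0%E.
  apply/eqP; rewrite eq_le measure_ge0 andbT.
  rewrite -(cvg_lim _ V0)//; apply: lime_ge; first by apply/cvg_ex; exists 0%E.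
  near=> N; apply: (@le_trans _ _ (mu (iter N.+1 T @` (V N `&` Y)) + mu (~` Y))%E).
    apply: le_trans (measureU2 mu _ (measurableC mY)); last first.
      by apply: iter_image_measurable; exact: measurableI.
    apply: le_measure; rewrite ?inE//.
      apply: measurableU; last exact: measurableC.
      by apply: iter_image_measurable; exact: measurableI.
    move=> s h; have [_ [x Vx e]] := h N I.
    have [Ys|nYs] := pselect (Y s); [left|by right].
    by exists x => //; split => //; rewrite -(YT N.+1) e.
  rewrite (Y0 : mu _ = 0%E) adde0; apply: iter_image_le; exact: measurableI.
pose W N := Bad N `&` Y.
(* A small [Z N] says nothing about the size of its basin. But the [W N] decrease, and the sink of a
   point common to all of them lies in every [Z N], so the point lies in a translate of the null set
   [ZZ]. *)
have W0 : (fun N => mu (W N)) @ \oo --> 0%E.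
  rewrite (_ : 0%E = mu (\bigcap_N W N)); last first.
    apply/esym/eqP; rewrite eq_le measure_ge0 andbT.
    apply: (@le_trans _ _ (mu (\bigcup_k (if unpickle k is Some g then rho g @^-1` ZZ else set0)))).
      apply: le_measure; rewrite ?inE.
      - by apply: bigcapT_measurable => N; exact: measurableI.
      - apply: bigcupT_measurable => k; case: (unpickle k) => // g.
        exact: act_preimage_measurable.
      - move=> x h; have [_ Yx] := h 0%N I; have [k hk] := Yh x Yx.
        have [g e] := iter_orbit k x; exists (pickle g) => //; rewrite pickleK /= -e.
        move=> N _; have [[a _ /= za] _] := h N I.
        have [ak|ka] := leqP a k.
          by rewrite (halt_iter_le ak)//; exact: za.1.
        by rewrite -(halt_iter_le (ltnW ka)).
    apply: le_trans (generalized_Boole_inequality mu _ _) _.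
    + by move=> k; case: (unpickle k) => // g; exact: act_preimage_measurable.
    + apply: bigcupT_measurable => k; case: (unpickle k) => // g.
      exact: act_preimage_measurable.
    + rewrite (eq_eseriesr (g := fun=> 0%E)); first by rewrite eseries0.
      move=> k _; case: (unpickle k) => [g|]; last exact: measure0.
      exact: etrans (act_measure_preserving rho g mZZ) ZZ0.
  apply: nonincreasing_cvg_mu.
  - exact: le_lt_trans (probability_le1 mu (measurableI _ _ (mBad 0%N) mY)) (ltry _).
  - by move=> N; exact: measurableI.
  - by apply: bigcapT_measurable => N; exact: measurableI.
  - move=> N K NK; apply/subsetPset => x [[a _ za] Yx]; split => //; exists a => //.
    exact: (ndZ' _ _ NK).
exists (fun N => Y `\` Bad N); split.
- by move=> N; exact: measurableD.
- move=> N x; have YTx := YT 1%N x; split=> -[/YTx Yx nb]; split => // -[a _ za]; apply: nb.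
  + case: a za => [|a] za; last by exists a => //=; rewrite -iterSr.
    by exists 0%N => //=; rewrite (halt_fixed za.1).
  + by exists a.+1 => //; rewrite /preimage /= -iterS iterSr.
- move=> N x [Yx nb]; apply: contrapT => hN; apply: nb.
  have ex : exists k, `[< halt (iter k T x) >] by have [k hk] := Yh x Yx; exists k; apply/asboolP.
  case: (ex_minnP ex) => k /asboolP hk kmin.
  have Nk : (N < k)%N.
    rewrite ltnNge; apply/negP => kN; apply: hN; by rewrite (halt_iter_le kN).
  (* With [k] the first halting time and [k > N], the configuration [N.+1] steps earlier has not
     halted after [N] further steps, so the sink of [x] belongs to [Z N]. *)
  exists k => //; split => //; exists (iter (k - N.+1) T x); last by rewrite -iterD subnKC.
  move=> /=; rewrite -iterD => h.
  have : (k <= N + (k - N.+1))%N by apply: kmin; apply/asboolP.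
  by rewrite leqNgt => /negP; apply; rewrite -[ltnRHS](subnKC Nk) addSn.
- by move=> N x y [Yx _]; exact: Yi.
- rewrite (_ : (fun N => _) = fun N => mu (W N)) => //; apply/funext => N.
  have -> : ~` (Y `\` Bad N) = ~` Y `|` W N.
    apply/seteqP; split => x.
    - move=> h; have [Yx|nYx] := pselect (Y x); [right|by left].
      by split => //; apply: contrapT => nb; apply: h.
    - by move=> [nY|[b _]] [Yx nb]; [exact: nY|exact: nb].
  have e : mu (~` Y `|` W N) = (mu (~` Y) + mu (W N))%E.
    apply: measureU; [exact: measurableC|exact: measurableI|].
    by rewrite -subset0 => x [nY [_ Yx]].
  by rewrite e (Y0 : mu (~` Y) = 0%E) add0e.
Unshelve. all: end_near. Qed.

End dynamics.

(** * The kernel of the Turing operator *)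

Section transfer.
Context (R : realType) d (X : measurableType d) (mu : probability X R).
Context d' (Gam : discreteGroupType d').
Variable rho : pmp_action mu Gam.
Context n (M : turing_system X Gam n).
Local Notation C := R[i].
Local Notation GG := (X * Gam)%type.
Local Notation gm := (gmeas mu Gam).
Local Notation op := (op GG R).
Local Notation grng := (grng rho).
Local Notation gpoly := (gpoly rho).
Local Notation T := (turing_map rho M).
Local Notation halt := (acc M `|` rej M).
Implicit Types (F G : GG -> C) (e : GG).

Lemma bounded_measurable_indic (U : set X) : measurable U ->
  bounded_measurable (\1_U : X -> R).
Proof.
move=> mU; split; first exact: measurable_indic.
by exists 1 => x; rewrite indicE ger0_norm// lern1 leq_b1.
Qed.

Definition chi (U : set X) : op := rmul_op rho \1_U.

Lemma chiE U F e : chi U F e = (grng e \in U)%:R * F e.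
Proof. by rewrite /chi /rmul_op /mul_op indicE rmorph_nat. Qed.

Lemma chi_opE U : chi_op rho U = chi U.
Proof.
apply/funext => F; apply/funext => e.
by rewrite chiE /chi_op /mul_op indicE.
Qed.

Lemma gpoly_chi U : measurable U -> gpoly (chi U).
Proof. by move=> mU; apply: gpoly_mul; exact: bounded_measurable_indic. Qed.

Lemma chi_id U F : (forall e, F e <> 0 -> U (grng e)) -> chi U F = F.
Proof.
move=> h; apply/funext => e; rewrite chiE.
have [->|/eqP Fe] := eqVneq (F e) 0; first by rewrite mulr0.
by rewrite mem_set ?mul1r//; exact: h.
Qed.

Lemma chi_eq0 U F : (forall e, F e <> 0 -> ~ U (grng e)) -> chi U F = (fun=> 0).
Proof.
move=> h; apply/funext => e; rewrite chiE.
have [->|/eqP Fe] := eqVneq (F e) 0; first by rewrite mulr0.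
by rewrite memNset ?mul0r//; exact: h.
Qed.

Lemma chi_chi U V F : chi U (chi V F) = chi (U `&` V) F.
Proof. by apply/funext => e; rewrite !chiE mulrA -natrM mulnb in_setI. Qed.

Lemma gpoly_0 : gpoly 0.
Proof.
rewrite (_ : 0 = rmul_op rho (fun=> 0)).
  apply: gpoly_mul; split; first exact: measurable_cst.
  by exists 0 => x; rewrite normr0.
by apply/funext => F; apply/funext => e; rewrite /rmul_op /mul_op mul0r.
Qed.

Lemma gpoly_sum (A : 'I_n -> op) : (forall i, gpoly (A i)) -> gpoly (\sum_i A i).
Proof.
move=> gA; apply: (big_ind gpoly); [exact: gpoly_0|exact: gpoly_add|].
by move=> i _; exact: gA.
Qed.

Lemma sum_opE (A : 'I_n -> op) F e : (\sum_i A i) F e = \sum_i A i F e.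
Proof. by rewrite !fct_sumE. Qed.

Lemma turing_opE F e : turing_op rho M F e =
  \sum_i (rho (elt M i)^-1%g (grng e) \in piece M i)%:R * F (e.1, (e.2 * (elt M i)^-1)%g).
Proof.
rewrite /turing_op sum_opE; apply: eq_bigr => i _.
by rewrite chi_opE /= group_opE chiE /grng /= actM.
Qed.

Lemma gpoly_turing_op : gpoly (turing_op rho M).
Proof.
apply: gpoly_sum => i; apply: gpoly_comp; first exact: gpoly_group.
by rewrite chi_opE; apply: gpoly_chi; exact: piece_measurable.
Qed.

Definition turing_D : op := turing_op rho M + chi_op rho setT - chi_op rho (init M)
  - chi_op rho (acc M) - chi_op rho (rej M).

Lemma gpoly_turing_D : gpoly turing_D.
Proof.
rewrite /turing_D !chi_opE.
have gN U : measurable U -> gpoly (- chi U) by move=> mU; apply/gpoly_opp/gpoly_chi.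
apply: gpoly_add; last exact/gN/rej_measurable.
apply: gpoly_add; last exact/gN/acc_measurable.
apply: gpoly_add; last exact/gN/init_measurable.
by apply: gpoly_add; [exact: gpoly_turing_op|exact: gpoly_chi].
Qed.

(** * The active dynamics on an invariant set and its Neumann series *)

Variables (B : set X) (N : nat).
Hypothesis mB : measurable B.
Hypothesis BT : forall x, B (T x) <-> B x.
Hypothesis Bhalt : forall x, B x -> halt (iter N T x).
Hypothesis Binit : forall x y, B x -> init M x -> T y <> x.

Definition active i := (piece M i `\` halt) `&` B.

Lemma active_measurable i : measurable (active i).
Proof.
apply: measurableI => //; apply: measurableD; first exact: piece_measurable.
exact: halt_measurable.
Qed.

Lemma activeP x : (exists i, active i x) <-> B x /\ ~ halt x.
Proof.
split=> [[i [[_ nh] Bx]]//|[Bx nh]].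
by have [i hi] := ex_piece M x; exists i.
Qed.

Lemma active_map i x : active i x -> T x = rho (elt M i) x.
Proof. by move=> [[hi _] _]; exact: turing_mapE. Qed.

Definition step : op := \sum_i (group_op rho (elt M i) \o chi (active i)).
Definition step_adj : op := \sum_i (chi (active i) \o group_op rho (elt M i)^-1%g).

Lemma gpoly_step : gpoly step.
Proof.
apply: gpoly_sum => i; apply: gpoly_comp; first exact: gpoly_group.
exact/gpoly_chi/active_measurable.
Qed.

Lemma gpoly_step_adj : gpoly step_adj.
Proof.
apply: gpoly_sum => i; apply: gpoly_comp; last exact: gpoly_group.
exact/gpoly_chi/active_measurable.
Qed.

Lemma stepE F e : step F e =
  \sum_i (rho (elt M i)^-1%g (grng e) \in active i)%:R * F (e.1, (e.2 * (elt M i)^-1)%g).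
Proof.
rewrite /step sum_opE; apply: eq_bigr => i _ /=.
by rewrite group_opE chiE /grng /= actM.
Qed.

Lemma step_adjE F e : step_adj F e =
  \sum_i (grng e \in active i)%:R * F (e.1, (e.2 * elt M i)%g).
Proof.
rewrite /step_adj sum_opE; apply: eq_bigr => i _ /=.
by rewrite chiE group_opE invgK.
Qed.

(** [step F e] is a sum of values of [F] at arrows whose range is active and moves to the range of
    [e]. The support arguments below reduce to this. *)
Lemma step_eq0 F e :
  (forall e', B (grng e') -> ~ halt (grng e') -> T (grng e') = grng e -> F e' = 0) ->
  step F e = 0.
Proof.
move=> h; rewrite stepE big1// => i _.
have [|_] := boolP (_ \in active i); last by rewrite mul0r.
rewrite inE => ai; rewrite h ?mulr0 => //.
- by case: ai; rewrite /grng /= actM.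
- by case: ai => -[_]; rewrite /grng /= actM.
- by rewrite /grng /= actM (active_map ai) -actM mulVg act1.
Qed.

Lemma step_ext F G : (forall e, B (grng e) -> ~ halt (grng e) -> F e = G e) ->
  step F = step G.
Proof.
move=> h; apply/funext => e; apply/eqP; rewrite -subr_eq0; apply/eqP.
rewrite -[LHS]/((step F \- step G) e) -(gpolyB _ _ gpoly_step).
by apply: step_eq0 => e' Be nh _ /=; rewrite h// subrr.
Qed.

Lemma step_chi_halt U F : U `<=` halt -> step (chi U F) = (fun=> 0).
Proof.
move=> Uh; apply/funext => e; apply: step_eq0 => e' _ nh _.
by rewrite chiE memNset ?mul0r// => /Uh.
Qed.

Lemma chi_step_adj_halt U F : U `<=` halt -> chi U (step_adj F) = (fun=> 0).
Proof.
move=> Uh; apply: chi_eq0 => e; rewrite step_adjE => h /Uh he; apply: h.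
rewrite big1// => i _; rewrite memNset ?mul0r//.
by move=> -[[_ nh] _].
Qed.

Lemma step_chiB F : step (chi B F) = step F.
Proof. by apply: step_ext => e Be _; rewrite chiE mem_set// mul1r. Qed.

Lemma chiB_step F : chi B (step F) = step F.
Proof.
apply: chi_id => e nz; apply: contrapT => nB; apply: nz.
by apply: step_eq0 => e' Be' _ te; exfalso; apply: nB; rewrite -te BT.
Qed.

Lemma chi_init_step F : chi (init M) (step F) = (fun=> 0).
Proof.
apply: chi_eq0 => e nz ie; apply: nz; apply: step_eq0 => e' Be' _ te; exfalso.
by apply: (Binit _ ie te); rewrite -te BT.
Qed.

Lemma iter_step_eq0 j F e :
  (forall y, iter j T y = grng e ->
    ~ forall i, (i < j)%N -> B (iter i T y) /\ ~ halt (iter i T y)) ->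
  (0 < j)%N -> iter j step F e = 0.
Proof.
elim: j e => // -[|j] IH e h _.
- apply: step_eq0 => e' Be' nh te; exfalso; apply: (h _ te) => i.
  by rewrite ltnS leqn0 => /eqP ->.
- rewrite iterS; apply: step_eq0 => e' Be' nh te; apply: IH => // y ye hy.
  apply: (h y); first by rewrite iterS ye.
  move=> i; rewrite ltnS leq_eqVlt => /orP[/eqP ->|]; last exact: hy.
  by rewrite ye.
Qed.

(** A nonzero value requires [N.+1] consecutive active configurations, the last of which is
    [iter N T y], and this one has halted. *)
Lemma step_nilpotent F : iter N.+1 step F = (fun=> 0).
Proof.
apply/funext => e; apply: iter_step_eq0 => // y _ h.
have [By _] := h 0%N isT; have [_] := h N (ltnSn N); apply.
exact: Bhalt.
Qed.

(* Truncated Neumann series for the inverse of [1 + step]. *)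
Fixpoint neumann j : op :=
  if j is j'.+1 then fun F => F \- neumann j' (step F) else id.

(** The new factor is outermost here and innermost in [neumann], so that [step] and [step_adj] meet
    in the middle of the product [neumann_neumann_adj]. *)
Fixpoint neumann_adj j : op :=
  if j is j'.+1 then fun F => F \- step_adj (neumann_adj j' F) else id.

Lemma gpoly_id : gpoly (id : op).
Proof.
rewrite (_ : id = chi setT); first exact: gpoly_chi.
by apply/funext => F; apply/funext => e; rewrite chiE in_setT mul1r.
Qed.

Lemma gpoly_neumann j : gpoly (neumann j).
Proof.
elim: j => [|j IH]; first exact: gpoly_id.
rewrite (_ : neumann j.+1 = id + - (neumann j \o step))//.
by apply: gpoly_add; [exact: gpoly_id|apply: gpoly_opp; apply: gpoly_comp => //; exact: gpoly_step].
Qed.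

Lemma gpoly_neumann_adj j : gpoly (neumann_adj j).
Proof.
elim: j => [|j IH]; first exact: gpoly_id.
rewrite (_ : neumann_adj j.+1 = id + - (step_adj \o neumann_adj j))//.
apply: gpoly_add; first exact: gpoly_id.
by apply: gpoly_opp; apply: gpoly_comp => //; exact: gpoly_step_adj.
Qed.

Lemma neumann_trunc j F :
  neumann j (F \+ step F) = F \+ (fun e => (-1) ^+ j * iter j.+1 step F e).
Proof.
elim: j F => [|j IH] F; first by apply/funext => e /=; rewrite mul1r.
rewrite -[LHS]/((F \+ step F) \- neumann j (step (F \+ step F))).
rewrite (gpolyD _ _ gpoly_step) IH; apply/funext => e /=.
by rewrite -iterSr exprS /=; ring.
Qed.

Lemma trunc_neumann j F :
  neumann j F \+ step (neumann j F) = F \+ (fun e => (-1) ^+ j * iter j.+1 step F e).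
Proof.
elim: j F => [|j IH] F; first by apply/funext => e /=; rewrite mul1r.
rewrite -[neumann j.+1 F]/(F \- neumann j (step F)) (gpolyB _ _ gpoly_step).
apply/funext => e /=.
have := congr1 (fun G => G e) (IH (step F)); rewrite /= -iterSr /= => h.
rewrite exprS mulN1r mulNr.
rewrite [X in _ = _ - X](_ : _ = neumann j (step F) e + step (neumann j (step F)) e - step F e).
  by ring.
by rewrite h; ring.
Qed.

Lemma neumannK F : neumann N (F \+ step F) = F.
Proof.
by rewrite neumann_trunc step_nilpotent; apply/funext => e /=; rewrite mulr0 addr0.
Qed.

Lemma neumannVK F : neumann N F \+ step (neumann N F) = F.
Proof.
by rewrite trunc_neumann step_nilpotent; apply/funext => e /=; rewrite mulr0 addr0.
Qed.

(** Only the zeroth term of the series survives on initial configurations, as no step ends there. *)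
Lemma chi_init_neumann j F : chi (init M) (neumann j F) = chi (init M) F.
Proof.
have gI := gpoly_chi (init_measurable M).
elim: j F => // j IH F.
rewrite -[neumann j.+1 F]/(F \- neumann j (step F)) (gpolyB _ _ gI) IH chi_init_step.
by apply/funext => e /=; rewrite subr0.
Qed.

Lemma chiB_neumann j F : chi B (neumann j F) = neumann j (chi B F).
Proof.
have gB := gpoly_chi mB.
elim: j F => // j IH F.
rewrite -[neumann j.+1 F]/(F \- neumann j (step F)) (gpolyB _ _ gB) IH chiB_step.
by rewrite -[neumann j.+1 _]/(chi B F \- neumann j (step (chi B F))) step_chiB.
Qed.

(** The transfer operator of the active dynamics. An active preimage of [y] lies in exactly one
    piece, so it is counted once, and there are at most [n] of them. *)
Definition back (f : X -> nat) (y : X) : nat :=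
  (\sum_i (rho (elt M i)^-1%g y \in active i) * f (rho (elt M i)^-1%g y))%N.

(* [weight j f y] sums [f] over the configurations from which [y] is reached in
   at most [j] active steps. *)
Fixpoint weight j (f : X -> nat) : X -> nat :=
  if j is j'.+1 then fun y => (f y + weight j' (back f) y)%N else f.

Definition natmul_op (f : X -> nat) : op := rmul_op rho (fun x => (f x)%:R).

Lemma natmul_opE f F e : natmul_op f F e = (f (grng e))%:R * F e.
Proof. by rewrite /natmul_op /rmul_op /mul_op rmorph_nat. Qed.

(** A configuration has one successor: going back along piece [i] and forward again must use piece
    [i], so the cross terms vanish and a multiplication operator remains. *)
Lemma step_step_adj f F : step (natmul_op f (step_adj F)) = natmul_op (back f) F.
Proof.
apply/funext => e; rewrite stepE natmul_opE /back natr_sum mulr_suml.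
apply: eq_bigr => i _; rewrite natrM -mulrA.
set y := rho _ _.
have ye : grng (e.1, (e.2 * (elt M i)^-1)%g) = y by rewrite /y /grng /= actM.
have [yi|_] := boolP (y \in active i); last by rewrite !mul0r.
congr (_ * _); rewrite natmul_opE ye; congr (_ * _).
rewrite step_adjE ye (bigD1 i)//= yi mul1r big1 ?addr0 => [|j ji].
  by rewrite mulgVK; case: e {y ye yi}.
rewrite memNset ?mul0r// => yj; move: yi; rewrite inE => yi.
by move: ji; rewrite (piece_inj yi.1.1 yj.1.1) eqxx.
Qed.

(** [step] vanishes on functions supported at sinks, and [step_adj] produces nothing at sinks.
    Between two copies of [chi U] only terms with equally many factors [step] and [step_adj]
    survive; their signs cancel, leaving a sum without signs. *)
Lemma neumann_neumann_adj j f U F : U `<=` halt ->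
  chi U (neumann j (natmul_op f (neumann_adj j (chi U F)))) =
  chi U (natmul_op (weight j f) F).
Proof.
have natmul_chi g V G : natmul_op g (chi V G) = chi V (natmul_op g G).
  by apply/funext => e; rewrite natmul_opE !chiE natmul_opE mulrCA.
have gm0 g : (forall F' G', natmul_op g (F' \- G') = natmul_op g F' \- natmul_op g G').
  by move=> F' G'; apply/funext => e /=; rewrite !natmul_opE mulrBr.
move=> Uh; elim: j f F => [|j IH] f F /=.
  by rewrite natmul_chi; apply/funext => e; rewrite !chiE; case: (_ \in _); rewrite ?mul1r ?mul0r.
have chiB' G G' : chi U (G \- G') = chi U G \- chi U G'.
  by apply/funext => e /=; rewrite !chiE mulrBr.
rewrite !gm0 (gpolyB _ _ gpoly_step) (gpolyB _ _ (gpoly_neumann j)) !chiB'.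
rewrite step_step_adj IH natmul_chi step_chi_halt// (gpoly0 (gpoly_neumann j)).
rewrite -(natmul_chi f U (step_adj _)) chi_step_adj_halt//.
apply/funext => e /=; rewrite !(chiE, natmul_opE) natrD.
by case: (_ \in _); rewrite ?(mul0r, mulr0, mul1r, subr0, sub0r, opprK) ?mulrDl//; ring.
Qed.

Lemma backP f y : back f y <> 0%N <->
  exists x, [/\ B x, ~ halt x, T x = y & f x <> 0%N].
Proof.
split.
- move=> h; apply: contrapT => nx; apply: h; rewrite /back big1// => i _.
  have [|_] := boolP (_ \in active i); last by rewrite mul0n.
  rewrite inE mul1n => ai; apply: contrapT => nz; apply: nx.
  exists (rho (elt M i)^-1%g y); have [] := (activeP _).1 (ex_intro _ i ai); split => //.
  by rewrite (active_map ai) actKV.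
- move=> [x [Bx nh xy fx]] /eqP; rewrite /back sum_nat_eq0 => /forallP h.
  have [i ai] := (activeP x).2 (conj Bx nh); have := h i.
  by rewrite -xy (active_map ai) actVK mem_set//= mul1n => /eqP.
Qed.

Lemma weightP j f y : weight j f y <> 0%N <->
  exists k x, [/\ (k <= j)%N, f x <> 0%N, iter k T x = y &
    forall i, (i < k)%N -> B (iter i T x) /\ ~ halt (iter i T x)].
Proof.
elim: j f y => [|j IH] f y /=.
  split; first by move=> h; exists 0%N, y.
  by move=> [k [x [+ h1 h2 _]]]; rewrite leqn0 => /eqP k0; move: h2; rewrite k0 /= => <-.
split.
- have [f0|/eqP f0 _] := eqVneq (f y) 0%N; last by exists 0%N, y.
  rewrite f0 add0n => /IH[k [x [kj /backP[z [Bz nz zx fz]] xy hk]]].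
  exists k.+1, z; split => //; first by rewrite iterSr zx.
  by case=> [|i] // ik; rewrite iterSr zx; exact: hk.
- move=> [[|k] [x [kj fx xy hk]]].
    by move: xy => /= <-; move: fx; case: (f x).
  have h : weight j (back f) y <> 0%N.
    apply/IH; exists k, (T x); split => //.
    - by apply/backP; exists x; have [] := hk 0%N isT; split.
    - by rewrite -iterSr.
    - by move=> i ik; rewrite -iterSr; exact: hk.
  by move: h; case: (weight _ _ _) => // m _; rewrite addnS.
Qed.

Lemma neumann_supp j f F :
  (forall e, f (grng e) = 0%N -> F e = 0) ->
  forall e, weight j f (grng e) = 0%N -> neumann j F e = 0.
Proof.
elim: j f F => [|j IH] f F h e /=; first exact: h.
move=> /eqP; rewrite addn_eq0 => /andP[/eqP f0 /eqP w0].
rewrite h// (IH (back f))// ?subr0// => {e f0 w0} e b0.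
apply: step_eq0 => e' Be' nh te; apply: h; apply: contrapT => nf.
by have := (backP f (grng e)).2; rewrite b0; apply => //; exists (grng e').
Qed.

(** * The idempotent onto the kernel *)

Local Notation AB := (acc M `&` B).
Local Notation IB := (init M `&` B).

Lemma AB_measurable : measurable AB.
Proof. by apply: measurableI => //; exact: acc_measurable. Qed.

Lemma IB_measurable : measurable IB.
Proof. by apply: measurableI => //; exact: init_measurable. Qed.

Definition sources (x : X) : nat := x \in IB.

Lemma natmul_sources : natmul_op sources = chi IB.
Proof. by apply/funext => F; apply/funext => e; rewrite natmul_opE chiE. Qed.

Definition load : X -> nat := weight N sources.

Lemma back_measurable f : measurable_fun setT (fun x => (f x)%:R : R) ->
  measurable_fun setT (fun x => (back f x)%:R : R).
Proof.
move=> mf; rewrite (_ : (fun x => _) = fun y => \sum_i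
    (\1_(active i) (rho (elt M i)^-1%g y) * (f (rho (elt M i)^-1%g y))%:R)); last first.
  by apply/funext => y; rewrite natr_sum; apply: eq_bigr => i _; rewrite natrM indicE.
apply: measurable_sum => i; apply: measurable_funM.
- apply: measurableT_comp (act_measurable rho _).
  by apply: measurable_indic; exact: active_measurable.
- by apply: measurableT_comp mf (act_measurable rho _).
Qed.

Lemma weight_measurable j f : measurable_fun setT (fun x => (f x)%:R : R) ->
  measurable_fun setT (fun x => (weight j f x)%:R : R).
Proof.
elim: j f => [|j IH] f mf //=.
under eq_fun do rewrite natrD.
by apply: measurable_funD => //; apply: IH; exact: back_measurable.
Qed.

Lemma load_measurable : measurable_fun setT (fun x => (load x)%:R : R).
Proof.
apply: weight_measurable; rewrite (_ : (fun x => _) = \1_IB).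
  by apply: measurable_indic; exact: IB_measurable.
by apply/funext => x; rewrite indicE.
Qed.

Lemma load_level_measurable k : measurable [set x | load x = k].
Proof.
have := load_measurable measurableT (measurable_set1 (k%:R : R)); rewrite setTI.
rewrite (_ : _ @^-1` _ = [set x | load x = k])//.
apply/seteqP; split => x /=; last by move=> ->.
by move=> /eqP; rewrite eqr_nat => /eqP.
Qed.

(* [0^-1 = 0], so that [load_inv] vanishes where [load] does. *)
Definition load_inv (x : X) : R := (load x)%:R^-1.

Lemma load_inv_bounded : bounded_measurable load_inv.
Proof.
split.
- move=> _ Z mZ; rewrite setTI.
  rewrite (_ : _ @^-1` Z = \bigcup_(k in [set k : nat | Z (k%:R^-1 : R)]) [set x | load x = k]).
    by apply: bigcup_measurable => k _; exact: load_level_measurable.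
  apply/seteqP; split => x /=; first by move=> h; exists (load x).
  by move=> [k /= Zk lk]; rewrite /load_inv lk.
- exists 1 => x; rewrite ger0_norm ?invr_ge0// /load_inv.
  by case: (load x) => [|k]; rewrite ?invr0// invf_le1// ler1n.
Qed.

(* [collect] sends the unit mass at an initial configuration to its sink, up to
   sign; [collect \o emit] is the multiplication by the number of initial
   configurations that reach a given accepting sink. *)
Definition collect : op := chi AB \o (neumann N \o chi IB).
Definition emit : op := chi IB \o (neumann_adj N \o chi AB).
(** The subtracted operator replaces the data on the initial configurations leading to a common
    accepting sink by their signed average. As [collect \o emit] is multiplication by [load], it is
    idempotent, and what remains is annihilated by [collect]. *)
Definition balance : op := chi IB - (emit \o (rmul_op rho load_inv \o collect)).
Definition ker_idem : op := neumann N \o balance.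

Lemma gpoly_collect : gpoly collect.
Proof.
apply: gpoly_comp; first exact/gpoly_chi/AB_measurable.
by apply: gpoly_comp; [exact: gpoly_neumann|exact/gpoly_chi/IB_measurable].
Qed.

Lemma gpoly_emit : gpoly emit.
Proof.
apply: gpoly_comp; first exact/gpoly_chi/IB_measurable.
by apply: gpoly_comp; [exact: gpoly_neumann_adj|exact/gpoly_chi/AB_measurable].
Qed.

Lemma gpoly_load_collect : gpoly (rmul_op rho load_inv \o collect).
Proof.
by apply: gpoly_comp; [apply: gpoly_mul; exact: load_inv_bounded|exact: gpoly_collect].
Qed.

Lemma gpoly_balance : gpoly balance.
Proof.
apply: gpoly_add; first exact/gpoly_chi/IB_measurable.
by apply/gpoly_opp/gpoly_comp; [exact: gpoly_emit|exact: gpoly_load_collect].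
Qed.

Lemma gpoly_ker_idem : gpoly ker_idem.
Proof. by apply: gpoly_comp; [exact: gpoly_neumann|exact: gpoly_balance]. Qed.

Lemma AB_halt : AB `<=` halt. Proof. by move=> x [ax _]; left. Qed.

Lemma collect_emit F : collect (emit F) = chi AB (natmul_op load F).
Proof.
rewrite /collect /emit /= chi_chi setIid -natmul_sources.
exact: neumann_neumann_adj AB_halt.
Qed.

Definition reached : set X := AB `&` [set x | load x <> 0%N].

Lemma reached_measurable : measurable reached.
Proof.
apply: measurableI; first exact: AB_measurable.
rewrite (_ : [set x | _] = ~` [set x | load x = 0%N])//.
by apply: measurableC; exact: load_level_measurable.
Qed.

Lemma load_inv_load F : rmul_op rho load_inv (chi AB (natmul_op load F)) = chi reached F.
Proof.
apply/funext => e; rewrite chiE /rmul_op /mul_op chiE natmul_opE /load_inv.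
rewrite fmorphV rmorph_nat.
have [l0|l0] := eqVneq (load (grng e)) 0%N.
  by rewrite l0 mul0r !mulr0 memNset ?mul0r// => -[_ /=]; rewrite l0.
rewrite mulrCA mulKf ?pnatr_eq0//; congr (_%:R * _).
congr nat_of_bool; apply/idP/idP; rewrite !inE => h; last by case: h.
by split => //; exact/eqP.
Qed.

(** Where [load] is zero, [load_inv] is zero too; the division loses nothing because [collect F]
    already vanishes there. *)
Lemma collect_supp F e : collect F e <> 0 -> reached (grng e).
Proof.
rewrite /collect /= chiE => h; split.
  by apply: contrapT => nAB; apply: h; rewrite memNset ?mul0r.
move=> l0; apply: h; rewrite (neumann_supp (f := sources))// ?mulr0// => {e l0} e.
by rewrite /sources chiE => /eqP; rewrite eqb0 => /negbTE ->; rewrite mul0r.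
Qed.

Lemma chi_IB_balance F : chi IB (balance F) = balance F.
Proof.
apply: chi_id => e h; apply: contrapT => nIB; apply: h.
by rewrite /balance /emit !fctE /= !chiE memNset// !mul0r subr0.
Qed.

Lemma balance_chi_IB F : balance (chi IB F) = balance F.
Proof. by rewrite /balance !fctE /collect /= chi_chi setIid. Qed.

Lemma chiU_of_supp (U V : set X) F : U `<=` V -> chi U F = F -> chi V F = F.
Proof.
move=> UV <-; rewrite chi_chi; congr (chi _ _).
by rewrite setIC; apply/setIidl.
Qed.

Lemma chi_init_balance F : chi (init M) (balance F) = balance F.
Proof. by apply: (@chiU_of_supp IB); [exact: subIsetl|exact: chi_IB_balance]. Qed.

Lemma chiB_balance F : chi B (balance F) = balance F.
Proof. by apply: (@chiU_of_supp IB); [exact: subIsetr|exact: chi_IB_balance]. Qed.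

Lemma turing_D_expand F e : turing_D F e =
  turing_op rho M F e + F e - (grng e \in init M)%:R * F e - (grng e \in halt)%:R * F e.
Proof.
rewrite /turing_D !chi_opE !fctE !chiE in_setT mul1r -!addrA -!opprD -mulrDl.
congr (_ + (_ - (_ + _ * _))).
rewrite -natrD; congr (_%:R).
have [aa|na] := boolP (grng e \in acc M); have [rr|nr] := boolP (grng e \in rej M).
- exfalso; move: aa rr; rewrite !inE => aa rr.
  by have : (rej M `&` acc M) (grng e) by []; rewrite rej_acc.
- by rewrite mem_set//; left; move: aa; rewrite inE.
- by rewrite mem_set//; right; move: rr; rewrite inE.
- by rewrite memNset// => -[h|h]; [move: na|move: nr]; rewrite notin_setE.
Qed.

(** Halted pieces are moved by the neutral element, so their share of [T] is multiplication by the
    indicator of the halting set, which [D] subtracts again. *)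
Lemma turing_op_chiB F e : turing_op rho M (chi B F) e =
  step F e + (grng e \in halt)%:R * chi B F e.
Proof.
rewrite turing_opE stepE.
rewrite (_ : _ * _ = \sum_i (rho (elt M i)^-1%g (grng e) \in piece M i `&` halt)%:R *
    chi B F (e.1, (e.2 * (elt M i)^-1)%g)); last first.
  have [|nh] := boolP (grng e \in halt); last first.
    rewrite mul0r big1// => i _; rewrite memNset ?mul0r// => -[hi hh].
    by move: nh (hh); rewrite notin_setE (halt_elt hi hh) invg1 act1.
  rewrite inE mul1r => hh; have [i hi] := ex_piece M (grng e).
  rewrite (bigD1 i)//= (halt_elt hi hh) invg1 act1 mulg1 mem_set// mul1r.
  rewrite -surjective_pairing big1 ?addr0//.
  move=> j ji; rewrite memNset ?mul0r// => -[hj hhj].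
  move: (hj); rewrite {1}(halt_elt hj hhj) invg1 act1 => hj'.
  by move: ji; rewrite (piece_inj hi hj') eqxx.
rewrite -big_split /=; apply: eq_bigr => i _; rewrite chiE.
set y := rho _ _.
have ye : grng (e.1, (e.2 * (elt M i)^-1)%g) = y by rewrite /y /Defs.grng /= actM.
rewrite ye.
have [yi|nyi] := boolP (y \in piece M i); last first.
  rewrite (@memNset _ (active i)); last by move=> [[h _] _]; move: nyi; rewrite notin_setE.
  rewrite (@memNset _ (piece M i `&` halt)); last by move=> [h _]; move: nyi; rewrite notin_setE.
  by rewrite !mul0r addr0.
rewrite mul1r; move: yi; rewrite inE => yi.
have [hy|nhy] := pselect (halt y).
- rewrite (@memNset _ (active i)); last by move=> [[_ nh] _].
  by rewrite mul0r add0r (@mem_set _ (piece M i `&` halt)) ?mul1r.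
- rewrite (@memNset _ (piece M i `&` halt)); last by move=> [_].
  rewrite mul0r addr0; congr (_%:R * _); congr nat_of_bool.
  by apply/idP/idP; rewrite !inE => h; [split|case: h].
Qed.

Lemma turing_D_chiB F :
  turing_D (chi B F) = (step F \+ chi B F) \- chi (init M) (chi B F).
Proof.
by apply/funext => e; rewrite turing_D_expand turing_op_chiB /= (chiE (init M));
  move: (step F e) (chi B F e) => u v; ring.
Qed.

(** The Turing map neither leaves nor enters [B]. *)
Lemma chiB_turing_D F : chi B (turing_D F) = turing_D (chi B F).
Proof.
apply/funext => e; rewrite chiE !turing_D_expand !chiE !turing_opE.
set b := (grng e \in B)%:R; set t := \sum_i _; set t' := \sum_i _.
suff -> : t' = b * t by move: b t (F e) (_ \in _)%:R (_ \in _)%:R => b t u v w; ring.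
rewrite /t' /t mulr_sumr /b {b t t'}.
apply: eq_bigr => i _; rewrite chiE mulrCA.
have [yi|nyi] := boolP (_ \in piece M i); last by rewrite !mul0r !mulr0.
rewrite !mul1r; congr (_%:R * _); congr nat_of_bool.
rewrite /Defs.grng /= actM -/(grng e); move: yi; rewrite inE => yi.
have := BT (rho (elt M i)^-1%g (grng e)); rewrite (turing_mapE rho yi) actKV => h.
by apply/idP/idP; rewrite !inE => /h.
Qed.

(** On [B], [1 + step] undoes [neumann N] and returns [balance F]; the term with [chi (init M)]
    subtracts the same function, since [balance F] lives on initial configurations. *)
Lemma turing_D_ker_idem F : turing_D (ker_idem F) = (fun=> 0).
Proof.
have e1 : chi B (ker_idem F) = ker_idem F.
  by rewrite /ker_idem /= chiB_neumann chiB_balance.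
rewrite -e1 turing_D_chiB e1 /ker_idem /= chi_init_neumann chi_init_balance.
apply/funext => e /=.
have := congr1 (fun G => G e) (neumannVK (balance F)); rewrite /= addrC => ->.
by rewrite subrr.
Qed.

(** At accepting sinks [ker_idem F] is [collect (balance F)], that is, [collect F] minus
    [load * load_inv] times itself. *)
Lemma chi_acc_ker_idem F : chi (acc M) (ker_idem F) = (fun=> 0).
Proof.
have e1 : chi B (ker_idem F) = ker_idem F.
  by rewrite /ker_idem /= chiB_neumann chiB_balance.
rewrite -e1 chi_chi /ker_idem /= -[balance F]chi_IB_balance.
rewrite -[LHS]/(collect (balance F)) /balance.
rewrite -[X in collect X]/(chi IB F \- emit (rmul_op rho load_inv (collect F))).
rewrite (gpolyB _ _ gpoly_collect) collect_emit.
have -> : collect (chi IB F) = collect F by rewrite /collect /= chi_chi setIid.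
apply/funext => e /=; rewrite chiE natmul_opE /rmul_op /mul_op /load_inv.
rewrite fmorphV rmorph_nat.
have [->|/eqP nz] := eqVneq (collect F e) 0; first by rewrite !mulr0 subr0.
have [ab l0] := collect_supp nz.
by rewrite mem_set// mul1r mulVKf ?subrr// pnatr_eq0; exact/eqP.
Qed.

(** Every term except [chi B F] contains [turing_D F] or [chi (acc M) F]. For [F] in the kernel
    these vanish only almost everywhere; an exact identity lets boundedness of the outer operators
    carry this through. *)
Lemma ker_idem_on F : ker_idem F =
  (chi B F \- neumann N (chi B (turing_D F))) \-
  neumann N (emit (rmul_op rho load_inv
    (chi B (chi (acc M) F) \- chi AB (neumann N (chi B (turing_D F)))))).
Proof.
(* On [B], [1 + step] is [D] plus [chi (init M)]; apply [neumann N] to both sides. *)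
have e1 : neumann N (chi IB F) = chi B F \- neumann N (chi B (turing_D F)).
  have gB := gpoly_chi mB; have gI := gpoly_chi (init_measurable M).
  rewrite chiB_turing_D turing_D_chiB.
  rewrite (gpolyB _ _ (gpoly_neumann N)) chi_chi -[step F](step_chiB).
  rewrite (_ : step (chi B F) \+ chi B F = chi B F \+ step (chi B F)); last first.
    by apply/funext => e /=; rewrite addrC.
  by rewrite neumannK; apply/funext => e /=; ring.
rewrite /ker_idem /= /balance.
rewrite -[X in neumann N X = _]/(chi IB F \- emit (rmul_op rho load_inv (collect F))).
rewrite (gpolyB _ _ (gpoly_neumann N)) e1; congr (_ \- neumann N (emit (rmul_op rho _ _))).
rewrite /collect /= e1 (gpolyB _ _ (gpoly_chi AB_measurable)) !chi_chi; congr (chi _ _ \- _).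
by rewrite -setIA setIid setIC.
Qed.

(** [balance] reads its argument only on [IB], where [neumann N F] and [F] agree. *)
Lemma balance_neumann F : balance (neumann N F) = balance F.
Proof.
rewrite -balance_chi_IB -[RHS]balance_chi_IB; congr balance.
by rewrite setIC -!chi_chi chi_init_neumann.
Qed.

End transfer.

(** * The kernel projection and its trace *)

Section dimension.
Context (R : realType) d (X : measurableType d) (mu : probability X R).
Context d' (Gam : discreteGroupType d').
Variable rho : pmp_action mu Gam.
Context n (M : turing_system X Gam n).
Local Notation C := R[i].
Local Notation Re := (@complex.Re R).
Local Notation Im := (@complex.Im R).
Local Notation GG := (X * Gam)%type.
Local Notation gm := (gmeas mu Gam).
Local Notation L2 := (cLfun gm 2%:E).
Local Notation nrm2 := (l2_sqn gm).
Local Notation rip := (l2_dot gm).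
Local Notation op := (op GG R).
Local Notation gpoly := (gpoly rho).
Local Notation chi0 := (@chi0 _ X R _ Gam).
Local Notation trace := (@trace _ X R mu _ Gam).
Local Notation T := (turing_map rho M).
Local Notation halt := (acc M `|` rej M).
Local Notation D := (turing_D rho M).
Local Notation chi := (chi rho).
Implicit Types (F G : GG -> C) (A : op).

Lemma gpoly_ae0 A F : gpoly A -> L2 F -> F = (fun=> 0) %[ae gm] -> A F = (fun=> 0) %[ae gm].
Proof.
move=> gA LF F0; rewrite -(gpoly0 gA).
exact: bounded_op_ae (gpoly_bounded gA) LF (L20 gm) F0.
Qed.

Lemma gpoly_ker_closed A (F_ : nat -> GG -> C) G : gpoly A ->
  (forall k, L2 (F_ k)) -> L2 G -> (forall k, A (F_ k) = (fun=> 0) %[ae gm]) ->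
  (forall k, nrm2 (G \- F_ k) <= 8^-1 ^+ k) -> A G = (fun=> 0) %[ae gm].
Proof.
move=> gA LF LG A0 hG; have LA := gpoly_L2 gA.
apply/ae_eq0_nrm2; first exact: LA.
have [K K0 hK] := gpoly_nrm2 gA.
have le k : nrm2 (A G) <= K * 8^-1 ^+ k.
  apply: (@le_trans _ _ (nrm2 (A (G \- F_ k)))).
    have -> : A G = A (G \- F_ k) \+ A (F_ k).
      by rewrite (gpolyB _ _ gA); apply/funext => e /=; rewrite subrK.
    have LB := LA _ (L2B LG (LF k)).
    rewrite nrm2D//; last exact: LA.
    have -> : nrm2 (A (F_ k)) = 0 by apply/ae_eq0_nrm2 => //; exact: LA.
    rewrite ripC (ae_eq_rip (LA _ (LF k)) (L20 gm) LB (A0 k)).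
    by rewrite (_ : (fun=> 0) = (fun t => 0%:C%C * A G t)) ?ripZl ?mul0r ?mulr0 ?addr0//;
      [exact: LA|apply/funext => e; rewrite mul0r].
  by apply: le_trans (hK _ (L2B LG (LF k))) _; rewrite ler_wpM2l.
apply/eqP; rewrite eq_le nrm2_ge0 andbT.
have c0 : (fun k => K * 8^-1 ^+ k) @ \oo --> K * 0.
  apply: cvgM; first exact: cvg_cst.
  by apply: cvg_expr; rewrite ger0_norm ?invr_ge0// invf_lt1// ltr1n.
rewrite mulr0 in c0; rewrite -(cvg_lim _ c0)//.
by apply: limr_ge; [apply/cvg_ex; exists 0|near=> k; exact: le].
Unshelve. all: end_near. Qed.

Definition kernel : set (GG -> C) :=
  [set F | [/\ L2 F, D F = (fun=> 0) %[ae gm] & chi (acc M) F = (fun=> 0) %[ae gm]]].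

Let gD : gpoly D. Proof. exact: gpoly_turing_D. Qed.
Let gA : gpoly (chi (acc M)). Proof. by apply: gpoly_chi; exact: acc_measurable. Qed.

Lemma kernel_closed : closed_subspace gm kernel.
Proof.
split.
- by move=> F [].
- by split; [exact: L20|rewrite (gpoly0 gD); exact: aeW|rewrite (gpoly0 gA); exact: aeW].
- move=> c F G [LF DF AF] [LG DG AG]; split.
  + by apply: L2D => //; exact: L2Z.
  + rewrite (gpoly_linear gD); apply: filterS2 DF DG => e /(_ I) h1 /(_ I) h2 _.
    by rewrite h1 h2 mulr0 addr0.
  + rewrite (gpoly_linear gA); apply: filterS2 AF AG => e /(_ I) h1 /(_ I) h2 _.
    by rewrite h1 h2 mulr0 addr0.
- move=> F_ G kF LG hG; split => //.
  + by apply: (gpoly_ker_closed gD) LG _ hG => k; have [] := kF k.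
  + by apply: (gpoly_ker_closed gA) LG _ hG => k; have [] := kF k.
Qed.

Lemma ltrans_ae0 A a F : gpoly A -> L2 F -> A F = (fun=> 0) %[ae gm] ->
  A (ltrans rho a F) = (fun=> 0) %[ae gm].
Proof.
move=> gA' LF A0; have [_ tA _] := gpoly_left_invariant gA'.
apply: ae_eq_trans (tA a F LF) _; have LA := gpoly_L2 gA' LF.
apply/ae_eq0_nrm2; first exact: L2_ltrans.
rewrite (nrm2_fibre_map rho _ (@ltrans_cancel _ _ a) (@ltrans_cancelV _ _ a))//.
exact/ae_eq0_nrm2.
Qed.

Lemma smul_ae0 A r F : gpoly A -> bounded_measurable r -> L2 F ->
  A F = (fun=> 0) %[ae gm] -> A (smul r F) = (fun=> 0) %[ae gm].
Proof.
move=> gA' br LF A0; have [_ _ sA] := gpoly_left_invariant gA'.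
apply: ae_eq_trans (sA r F br LF) _.
by apply: filterS A0 => e /(_ I) h _; rewrite /smul /rmul h mulr0.
Qed.

Lemma adjointP : is_adjoint gm D (adjoint gm D).
Proof. by have [D' hD'] := gpoly_is_adjoint gD; apply: xgetPex; exists D'. Qed.

Lemma turing_SE : turing_S rho M = adjoint gm D \o D + chi (acc M).
Proof. by rewrite -chi_opE. Qed.

(** Pairing [S F] with [F] gives [nrm2 (D F) + nrm2 (chi (acc M) F)]. *)
Lemma ker_turing_S : ker_op gm (turing_S rho M) = kernel.
Proof.
have [bA adj] := adjointP; have [LA _ _] := bA.
apply/seteqP; split => F.
- move=> [LF SF]; have LD := gpoly_L2 gD LF; have LC := gpoly_L2 gA LF.
  have LAD := LA _ LD.
  have LS : L2 (turing_S rho M F) by rewrite turing_SE; exact: L2D.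
  have e0 : rip (turing_S rho M F) F = 0.
    rewrite (ae_eq_rip LS (L20 gm) LF SF).
    rewrite (_ : (fun=> 0) = (fun t => 0%:C%C * F t)) ?ripZl ?mul0r//.
    by apply/funext => e; rewrite mul0r.
  have e1 : rip (adjoint gm D (D F)) F = nrm2 (D F).
    by rewrite ripC -Re_inner -adj// Re_inner.
  have e2 : rip (chi (acc M) F) F = nrm2 (chi (acc M) F).
    rewrite -{1}(setIid (acc M)) -chi_chi; exact: rip_rmul_op.
  move: e0; rewrite turing_SE.
  rewrite -[X in rip X]/(adjoint gm D (D F) \+ chi (acc M) F) ripDl// e1 e2 => e0.
  have h1 := nrm2_ge0 gm (D F); have h2 := nrm2_ge0 gm (chi (acc M) F).
  by split => //; apply/ae_eq0_nrm2 => //; lra.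
- move=> [LF DF AF]; split => //; rewrite turing_SE.
  have LD := gpoly_L2 gD LF.
  have h0 : adjoint gm D (fun=> 0) = (fun=> 0) %[ae gm].
    apply/ae_eq0_nrm2; first exact/LA/L20.
    have [K _ hK] := bounded_op_nrm2 bA.
    apply/eqP; rewrite eq_le nrm2_ge0 andbT; apply: le_trans (hK _ (L20 gm)) _.
    have -> : nrm2 (fun=> 0) = 0 by apply/ae_eq0_nrm2; [exact: L20|exact: aeW].
    by rewrite mulr0.
  have h1 := bounded_op_ae bA LD (L20 gm) DF.
  apply: filterS3 h0 h1 AF => e /(_ I) e0 /(_ I) e1 /(_ I) e2 _.
  by rewrite !fctE /= e1 e0 e2 addr0.
Qed.

Lemma groupoid_ring_turing_S : groupoid_ring rho (turing_S rho M).
Proof.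
rewrite turing_SE; have gRD := gpoly_groupoid_ring gD.
apply: GR_add; last exact: gpoly_groupoid_ring.
by apply: GR_comp => //; exact: GR_adj gRD adjointP.
Qed.

Definition ker_proj : op := orth_proj gm (ker_op gm (turing_S rho M)).

Lemma ker_projP : is_orth_proj gm kernel ker_proj.
Proof.
rewrite /ker_proj ker_turing_S; have [Q hQ] := orth_proj_ex kernel_closed.
by apply: xgetPex; exists Q.
Qed.

Lemma ker_proj_left_invariant : left_invariant rho ker_proj.
Proof.
apply: orth_proj_left_invariant kernel_closed _ _ ker_projP.
- move=> a F [LF DF AF]; split; [exact: L2_ltrans|exact: ltrans_ae0|exact: ltrans_ae0].
- move=> r F br [LF DF AF]; split; [exact: L2_smul|exact: smul_ae0|exact: smul_ae0].
Qed.

Lemma ker_proj_id F : kernel F -> ker_proj F = F %[ae gm].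
Proof.
move=> kF; have [LF _ _] := kF; have [_ hQ] := ker_projP; have [kQ oQ] := hQ _ LF.
apply: (proj_unique kernel_closed LF kQ kF).
- by move=> G kG; rewrite -Re_inner; have := oQ G kG => ->.
- by move=> G [LG _ _]; rewrite ripBl// subrr.
Qed.

Lemma traceB A A' : gpoly A -> gpoly A' -> trace (A - A') = trace A - trace A'.
Proof.
move=> gA1 gA2; have L2c := L2_chi0 mu Gam.
rewrite /Defs.trace -[X in inner _ X]/(A chi0 \+ (\- A' chi0)).
have LN : L2 (\- A' chi0).
  by rewrite -[X in L2 X]/((- A') chi0); apply: (gpoly_L2 (gpoly_opp gA2)).
have LA1 := gpoly_L2 gA1 L2c; have LA2 := gpoly_L2 gA2 L2c.
by rewrite innerDl ?innerNl//.
Qed.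

(** * Traces over an invariant set *)

Section truncation.
Variables (B : set X) (N : nat).
Hypothesis mB : measurable B.
Hypothesis BT : forall x, B (T x) <-> B x.
Hypothesis Bhalt : forall x, B x -> halt (iter N T x).
Hypothesis Binit : forall x y, B x -> init M x -> T y <> x.

Lemma ker_idem_kernel F : L2 F -> kernel (ker_idem rho M B N F).
Proof.
move=> LF; split.
- exact: (gpoly_L2 (gpoly_ker_idem rho M N mB)).
- by rewrite (turing_D_ker_idem mB BT Bhalt Binit); exact: aeW.
- by rewrite (chi_acc_ker_idem N mB BT); exact: aeW.
Qed.

Lemma ker_idem_id F : kernel F -> ker_idem rho M B N F = chi B F %[ae gm].
Proof.
move=> [LF DF AF]; rewrite (ker_idem_on mB BT Bhalt).
have gB := gpoly_chi rho mB; have gN := gpoly_neumann rho M mB N.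
have gAB := gpoly_chi rho (AB_measurable M mB).
have gE := gpoly_emit rho M N mB.
have gL : gpoly (rmul_op rho (load_inv rho M B N)).
  by apply: gpoly_mul; exact: load_inv_bounded.
set U := neumann rho M B N (chi B (D F)).
have LD := gpoly_L2 gD LF.
have LU : L2 U by apply: (gpoly_L2 gN); exact: (gpoly_L2 gB).
have U0 : U = (fun=> 0) %[ae gm].
  apply: (gpoly_ae0 gN); first exact: (gpoly_L2 gB).
  exact: (gpoly_ae0 gB).
set V := chi B (chi (acc M) F) \- chi _ U.
have LA := gpoly_L2 gA LF.
have LV : L2 V by apply: L2B; [exact: (gpoly_L2 gB)|exact: (gpoly_L2 gAB)].
have V0 : V = (fun=> 0) %[ae gm].
  have h1 := gpoly_ae0 gB LA AF; have h2 := gpoly_ae0 gAB LU U0.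
  by apply: filterS2 h1 h2 => e /(_ I) h1 /(_ I) h2 _; rewrite /V /= h1 h2 subrr.
have LW := gpoly_L2 gL LV; have W0 := gpoly_ae0 gL LV V0.
have LE := gpoly_L2 gE LW; have E0 := gpoly_ae0 gE LW W0.
have K0 := gpoly_ae0 gN LE E0.
by apply: filterS2 U0 K0 => e /(_ I) h1 /(_ I) h2 _; rewrite /= h1 h2 !subr0.
Qed.

(** Moving [emit] to the right turns the averaging operator into [load_inv \o collect \o emit], the
    indicator of the reached sinks. *)
Lemma trace_balance : trace (balance rho M B N) =
  (fine (mu (init M `&` B)) - fine (mu (reached rho M B N)))%:C%C.
Proof.
have gIB := gpoly_chi rho (IB_measurable M mB).
have gE := gpoly_emit rho M N mB; have gL := gpoly_load_collect rho M N mB.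
rewrite /balance traceB//; last exact: gpoly_comp.
rewrite (trace_cyclic gE (gpoly_left_invariant gL)).
have -> : (rmul_op rho (load_inv rho M B N) \o collect rho M B N) \o emit rho M B N =
    chi (reached rho M B N).
  apply/funext => F; rewrite /= (collect_emit rho M N mB).
  exact: load_inv_load.
rewrite !trace_indic ?rmorphB//; first exact: (reached_measurable rho M N mB).
exact: (IB_measurable M mB).
Qed.

(** With [Q] the projection and [E] the idempotent, [chi B Q = E Q] has the trace of [Q E = E]. A
    second swap puts [neumann N] to the right of [balance], which absorbs it. *)
Lemma trace_chi_ker_proj : trace (chi B \o ker_proj) =
  (fine (mu (init M `&` B)) - fine (mu (reached rho M B N)))%:C%C.
Proof.
have gB := gpoly_chi rho mB; have gN := gpoly_neumann rho M mB N.
have gE := gpoly_ker_idem rho M N mB; have gBal := gpoly_balance rho M N mB.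
have L2c := L2_chi0 mu Gam.
have [[LQ _ _] hQ] := ker_projP; have [kQ _] := hQ _ L2c.
have kE := ker_idem_kernel L2c; have [LE _ _] := kE.
transitivity (trace (ker_idem rho M B N \o ker_proj)).
  apply: ae_eq_inner => //; [exact/(gpoly_L2 gB)/LQ|exact/(gpoly_L2 gE)/LQ|].
  apply: ae_eq_sym; exact: ker_idem_id.
rewrite (trace_cyclic gE ker_proj_left_invariant).
transitivity (trace (ker_idem rho M B N)).
  apply: ae_eq_inner => //; [exact: LQ|exact: ker_proj_id].
rewrite (trace_cyclic gN (gpoly_left_invariant gBal)).
rewrite (_ : _ \o _ = balance rho M B N); first exact: trace_balance.
by apply/funext => F /=; exact: (balance_neumann N BT Binit).
Qed.

(** In [B] an initial configuration has no preimage, and cutting its orbit at the first halting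
    time, which is at most [N], leaves active steps only. *)
Lemma reachedE : reached rho M B N = fund2 rho M `&` B.
Proof.
have BTi k x : B (iter k T x) <-> B x.
  by elim: k => //= k IH; rewrite BT.
apply/seteqP; split => s.
- move=> [[as_ Bs] /= /weightP[k [x [_ sx xs _]]]]; split => //; apply/fund2P; split => //.
  have : (init M `&` B) x.
    by move: sx; rewrite /sources; case: (boolP (x \in _)) => //; rewrite inE.
  move=> [ix Bx]; exists k, x; split => // -[y yx].
  exact: (Binit Bx ix yx).
- move=> [/fund2P[as_ [k [x [ix nx xs]]]] Bs]; split => //=.
  have Bx : B x by apply/(BTi k); rewrite xs.
  have ex : exists k, `[< halt (iter k T x) >].
    by exists k; apply/asboolP; rewrite xs; left.
  case: (ex_minnP ex) => j /asboolP hj jmin.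
  apply/weightP; exists j, x; split.
  + by apply: jmin; apply/asboolP; exact: Bhalt.
  + by rewrite /sources mem_set.
  + rewrite -xs; apply/esym; apply: halt_iter_le => //.
    by apply: jmin; apply/asboolP; rewrite xs; left.
  + move=> i ij; split; first by rewrite BTi.
    move=> hi; have : (j <= i)%N by apply: jmin; apply/asboolP.
    by rewrite leqNgt ij.
Qed.

Lemma nrm2_chi_chi0 (U : set X) : measurable U -> nrm2 (chi U chi0) = fine (mu U).
Proof.
move=> mU; have := congr1 Re (trace_indic rho mU).
rewrite /Defs.trace Re_inner /= => <-.
by rewrite -[in RHS](setIid U) -[RHS]/(rip (chi (U `&` U) chi0) chi0) -chi_chi rip_rmul_op.
Qed.

(** The difference is the inner product of [ker_proj chi0] with [chi (~] B)
    chi0[, whose squared norm is the measure of]~[B]. Cauchy-Schwarz applies to the real part, and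
    to the imaginary part after multiplication by ['i]. The constant [K] does not depend on [B]. *)
Lemma trace_truncation_error :
  let K := nrm2 (ker_proj chi0) in
  let z := trace ker_proj - trace (chi B \o ker_proj) in
  Re z ^+ 2 <= K * fine (mu (~` B)) /\ Im z ^+ 2 <= K * fine (mu (~` B)).
Proof.
have L2c := L2_chi0 mu Gam; have [[LQ _ _] _] := ker_projP.
have gC := gpoly_chi rho (measurableC mB).
have LC := gpoly_L2 gC L2c; have LQc := LQ _ L2c.
move=> K z.
have -> : z = inner gm (ker_proj chi0) (chi (~` B) chi0).
  have LB := gpoly_L2 (gpoly_chi rho mB) LQc.
  have LB' := gpoly_L2 gC LQc.
  have e1 : ker_proj chi0 = chi B (ker_proj chi0) \+ chi (~` B) (ker_proj chi0).
    apply/funext => e /=; rewrite !chiE in_setC.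
    by case: (_ \in B); rewrite /= mul1r mul0r (addr0, add0r).
  rewrite /z /Defs.trace /= {1}e1 innerDl// addrAC subrr add0r.
  apply: (inner_of_rip gC) => // G LG; exact: rip_rmul_op.
rewrite innerE /= -(nrm2_chi_chi0 (measurableC mB)); split; first exact: cauchy_schwarz.
apply: le_trans (cauchy_schwarz LQc (L2Z 'i%C LC)) _.
rewrite ler_wpM2l ?nrm2_ge0// le_eqVlt; apply/orP; left; apply/eqP.
apply: eq_Rintegral => e _; rewrite /rdot.
by case: (chi _ _ _) => a b /=; ring.
Qed.

End truncation.

Hypothesis stops : stops_on_any_configuration rho M.
Hypothesis norestart : does_not_restart rho M.

Lemma dim_vN_ker_turing_S : dim_vN_ker mu (turing_S rho M) =
  (fine (mu (init M)) - fine (Omega2 rho M))%:C%C.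
Proof.
have [B [mB BT Bh Bi cB]] := good_sets stops norestart.
pose eps N := fine (mu (~` B N)).
have c0 : eps @ \oo --> 0 by exact: fine_cvg cB.
have eps0 N : 0 <= eps N by rewrite fine_ge0.
have eps1 N : eps N <= 1.
  have mC := measurableC (mB N); have := probability_le1 mu mC.
  by rewrite -lee_fin /eps fineK//; exact: fin_num_measure.
have sq0 (x K : R) : 0 <= K -> (forall N, x ^+ 2 <= K * eps N) -> x = 0.
  move=> K0 h; apply/eqP; rewrite -sqrf_eq0 eq_le sqr_ge0 andbT.
  have cK : (fun N => K * eps N) @ \oo --> K * 0 by apply: cvgM => //; exact: cvg_cst.
  rewrite mulr0 in cK; rewrite -(cvg_lim _ cK)//.
  by apply: limr_ge; [apply/cvg_ex; exists 0|near=> N; exact: h].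
have diff (U : set X) N : measurable U ->
    0 <= fine (mu U) - fine (mu (U `&` B N)) <= eps N.
  move=> mU; have mI : measurable (U `&` B N) by exact: measurableI.
  have mD' : measurable (U `&` ~` B N) by apply: measurableI => //; exact: measurableC.
  have -> : mu U = (mu (U `&` B N) + mu (U `&` ~` B N))%E.
    rewrite -measureU//; first by rewrite -setIUr setUv setIT.
    by rewrite setIACA setICr setI0.
  rewrite fineD ?fin_num_measure// addrC addKr fine_ge0//=.
  apply: fine_le; rewrite ?fin_num_measure//; first exact: measurableC.
  by apply: le_measure; rewrite ?inE//; exact: measurableC.
pose K := nrm2 (ker_proj chi0).
have K0 : 0 <= K := nrm2_ge0 _ _.
rewrite /dim_vN_ker -/ker_proj; set z := Defs.trace mu ker_proj.
have h N : Re (z - trace (chi (B N) \o ker_proj)) ^+ 2 <= K * eps N /\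
    Im (z - trace (chi (B N) \o ker_proj)) ^+ 2 <= K * eps N.
  exact: trace_truncation_error (mB N).
clearbody z.
have e N : trace (chi (B N) \o ker_proj) =
    (fine (mu (init M `&` B N)) - fine (mu (fund2 rho M `&` B N)))%:C%C.
  rewrite (trace_chi_ker_proj (mB N) (BT N) (Bh N) (Bi N)).
  by rewrite (reachedE (BT N) (Bh N) (Bi N)).
have zI : Im z = 0.
  apply: (sq0 _ K) => // N; have [_] := h N; by rewrite e ImB (_ : Im _%:C%C = 0) ?subr0.
have zR : Re z - (fine (mu (init M)) - fine (Omega2 rho M)) = 0.
  (* The quantity is [x - y] with [x ^+ 2 <= K * t] and [y ^+ 2 <= t ^+ 2 <= t], where [t] is
     [eps N]. As [(x + y) ^+ 2 >= 0], its square is at most [2 * x ^+ 2 + 2 * y ^+ 2], so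
     [2 * K + 2] would do; [8] leaves slack. *)
  apply: (sq0 _ (2 * K + 8)); first lra.
  move=> N; have [+ _] := h N; rewrite e ReB /= => hN.
  have /andP[i0 i1] := diff _ N (init_measurable M).
  have /andP[f0 f1] := diff _ N (fund2_measurable rho M).
  move: hN i0 i1 f0 f1 (eps0 N) (eps1 N); rewrite /Omega2.
  move: (Re z) (fine (mu (init M))) (fine (mu (fund2 rho M))) => a b c.
  move: (fine (mu (init M `&` _))) (fine (mu (fund2 rho M `&` _))) (eps N) => b' c' t.
  move=> h1 h2 h3 h4 h5 t0 t1.
  have : (b - b' - (c - c')) ^+ 2 <= t ^+ 2.
    rewrite -[leLHS]real_normK ?num_real// ler_sqr ?nnegrE// ler_norml; lra.
  have : t ^+ 2 <= t by rewrite expr2 ler_piMl.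
  have := sqr_ge0 (a - (b' - c') + (b - b' - (c - c'))).
  have -> : (a - (b - c)) = (a - (b' - c')) - (b - b' - (c - c')) by ring.
  by rewrite sqrrD sqrrB; lra.
by case: z {h} zR zI => a b /= /eqP; rewrite subr_eq0 => /eqP -> ->.
Unshelve. all: end_near. Qed.

End dimension.

Theorem theorem4p3 (R : realType) (d d' : measure_display)
    (X : measurableType d) (mu : probability X R)
    (Gam : discreteGroupType d') (rho : pmp_action mu Gam)
    (n : nat) (M : turing_system X Gam n) :
  standard_borel R X ->
  stops_on_any_configuration rho M ->
  does_not_restart rho M ->
  [/\ groupoid_ring rho (turing_op rho M),
      groupoid_ring rho (turing_S rho M) &
      dim_vN_ker mu (turing_S rho M) =
        real_complex R (fine (mu (init M)) - fine (Omega2 rho M))].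
Proof.
move=> _ stops norestart; split.
- exact/gpoly_groupoid_ring/gpoly_turing_op.
- exact: groupoid_ring_turing_S.
- exact: dim_vN_ker_turing_S.
Qed.
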